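(* Let $\varphi:M\to G$ be an admissible mapping. Then there exists a local $\tilde H$-gauge transformation that transforms the connection ${}^\varphi\omega=\varphi^*\theta$ to a connection of the form displayed below. Precisely: let $W\subset M$ be an open set with coordinate $z$ on which $\mu_\pm,\nu_\pm,\eta_\pm,\gamma_\pm$ are defined as in the context. Then there is a mapping $\psi:W\to\tilde H$ such that $\varphi'=\varphi\psi$ satisfies on $W$ $${}^{\varphi'}\omega=\bigl(\sqrt{-1}\,x_-+({}^\gamma\omega)_-\bigr)dz+\sqrt{-1}\,\mathrm{Ad}(\gamma^{-1})x_+\,d\bar z,$$ where $\gamma:W\to\tilde H$ is given by $\gamma=\gamma_+^{-1}\,\eta\,\gamma_-$ with $\eta=\eta_-\eta_+^{-1}$.
   Context: $M$ is a one-dimensional complex manifold; all mappings are smooth; products and inverses of $G$-valued mappings are pointwise. $G$ is a connected complex semisimple Lie group with Lie algebra $\mathfrak g$, identified with $T_e^{(1,0)}(G)$; $L_g$ is left translation. $\theta$ is the holomorphic Maurer–Cartan form (the $\mathfrak g$-valued $(1,0)$-form on $G$ with $\theta(x)=L_{g^{-1}*}(x)$ for $x\in T^{(1,0)}_g(G)$), and ${}^\varphi\omega=\varphi^*\theta$ for $\varphi:M\to G$. Write $\omega=\omega_-dz+\omega_+d\bar z$ for a 1-form $\omega$. The gauge transformation by $\psi$ sends ${}^\varphi\omega$ to ${}^{\varphi\psi}\omega$; it is an $\tilde H$-gauge transformation if $\psi$ takes values in $\tilde H$. Gradation: $\mathfrak g=\bigoplus_{m\in\mathbb Z}\mathfrak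 g_m$ is a $\mathbb Z$-gradation, $\tilde{\mathfrak n}_-=\bigoplus_{m<0}\mathfrak g_m$, $\tilde{\mathfrak n}_+=\bigoplus_{m>0}\mathfrak g_m$, $\tilde{\mathfrak h}=\mathfrak g_0$, $\tilde{\mathfrak b}_\pm=\tilde{\mathfrak h}\oplus\tilde{\mathfrak n}_\pm$; $\tilde N_\pm,\tilde H,\tilde B_\pm$ are the corresponding connected subgroups. $F_\pm=G/\tilde B_\mp$, with projections $\pi_\pm:G\to F_\pm$, and $\varphi_\pm=\pi_\pm\circ\varphi$. Admissible mappings: fix nonzero $x_\pm\in\mathfrak g_{\pm1}$ and put $\mathcal O_\pm=\mathrm{Ad}(\tilde H)x_\pm$, $\mathcal O_{\pm g}=L_{g*}(\mathcal O_\pm)$. A mapping $\varphi:M\to G$ is admissible if (i) the $(1,0)$-component of ${}^\varphi\omega$ takes values in $\mathfrak g_{-1}\oplus\mathfrak g_0$ and the $(0,1)$-component in $\mathfrak g_0\oplus\mathfrak g_{+1}$, and (ii) for any $p\in M$, $\varphi_{-*}(\partial_z|_p)\in\pi_{-*}(\mathcal O_{-g})$ for any $g\in G$ with $\pi_-(g)=\varphi_-(p)$, and $\varphi_{+*}(\partial_{\bar z}|_p)\in\pi_{+*}(\mathcal O_{+g})$ for any $g\in G$ with $\pi_+(g)=\varphi_+(p)$ (independent of the coordinate $z$). Local data: near every point of $M$ there are elements $g_\pm\in G$ such that $\varphi$ decomposes uniquely as $\varphi=\mu_+\nu_-\eta_-=\mu_-\nu_+\eta_+$ with $\mu_\pm$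 taking values in $g_\pm\tilde N_\pm$, $\nu_\pm$ in $\tilde N_\pm$, and $\eta_\pm$ in $\tilde H$. For admissible $\varphi$ one has ${}^{\mu_-}\omega=\lambda_-dz$ and ${}^{\mu_+}\omega=\lambda_+d\bar z$ with $\lambda_\pm$ valued in $\mathcal O_\pm$, $\lambda_-$ holomorphic and $\lambda_+$ antiholomorphic. On a possibly smaller open set $W$ around the point one chooses $\gamma_\pm:W\to\tilde H$ with $\lambda_\pm=\sqrt{-1}\,\mathrm{Ad}(\gamma_\pm)x_\pm$, $\gamma_-$ holomorphic and $\gamma_+$ antiholomorphic. *)

(* Defs.v *)
From HB Require Import structures.
From mathcomp Require Import all_boot all_order all_algebra.
From mathcomp Require Import all_classical all_reals all_analysis.
From mathcomp Require Import complex.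

Set Implicit Arguments.
Unset Strict Implicit.
Unset Printing Implicit Defensive.

Import Order.TTheory GRing.Theory Num.Theory.
Import numFieldNormedType.Exports.

Local Open Scope classical_set_scope.
Local Open Scope ring_scope.

(** * Calculus on C^n *)

(* C^n as a real normed space: the pair (x, y) stands for x + i y.  Real
   differentiability is the library's; [cplx] and [realv] pass to and from the
   complex vector space of rows. *)
Definition Cn (R : realType) (n : nat) : normedModType R :=
  ('rV[R]_n * 'rV[R]_n)%type.

Definition cplx (R : realType) (n : nat) (v : Cn R n) : 'rV[R[i]]_n :=
  \row_j (v.1 0 j +i* v.2 0 j)%C.

Definition realv (R : realType) (n : nat) (v : 'rV[R[i]]_n) : Cn R n :=
  (map_mx (@complex.Re R) v, map_mx (@complex.Im R) v).

Definition mul_i (R : realType) (n : nat) (v : Cn R n) : Cn R n := (- v.2, v.1).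

Definition mul_i2 (R : realType) (m n : nat) (v : (Cn R m * Cn R n)%type) :
    (Cn R m * Cn R n)%type :=
  (mul_i v.1, mul_i v.2).

Definition conj_vec (R : realType) (n : nat) (v : Cn R n) : Cn R n := (v.1, - v.2).

Fixpoint Ck (R : realType) (V W : normedModType R) (k : nat) (U : set V)
    (f : V -> W) {struct k} : Prop :=
  if k is k'.+1 then
    (forall p, U p -> differentiable f p) /\ (forall v, Ck k' U ('D_v f))
  else forall p, U p -> {for p, continuous f}.

(* Meaningful for [U] open. *)
Definition smooth_on (R : realType) (V W : normedModType R) (U : set V)
    (f : V -> W) : Prop :=
  forall k, Ck k U f.

(* [JV], [JW] are the complex structures on [V] and [W]; the second clause is
   the system of Cauchy-Riemann equations. *)
Definition holomorphic_on (R : realType) (V W : normedModType R)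
    (JV : V -> V) (JW : W -> W) (U : set V) (f : V -> W) : Prop :=
  smooth_on U f /\ forall p v, U p -> 'D_(JV v) f p = JW ('D_v f p).

Definition d_x (R : realType) (n : nat) (f : Cn R 1 -> Cn R n) (p : Cn R 1) :
    'rV[R[i]]_n :=
  cplx ('D_((const_mx 1, 0) : Cn R 1) f p).

Definition d_y (R : realType) (n : nat) (f : Cn R 1 -> Cn R n) (p : Cn R 1) :
    'rV[R[i]]_n :=
  cplx ('D_((0, const_mx 1) : Cn R 1) f p).

Definition d_z (R : realType) (n : nat) (f : Cn R 1 -> Cn R n) (p : Cn R 1) :
    'rV[R[i]]_n :=
  2^-1 *: (d_x f p - 'i%C *: d_y f p).

Definition d_zbar (R : realType) (n : nat) (f : Cn R 1 -> Cn R n) (p : Cn R 1) :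
    'rV[R[i]]_n :=
  2^-1 *: (d_x f p + 'i%C *: d_y f p).

(** * Complex manifolds *)

(* [chart_inv] is the inverse of [chart_fun] on [chart_fun @` chart_dom]; the
   values of [chart_fun] outside [chart_dom] and of [chart_inv] outside
   [chart_fun @` chart_dom] are irrelevant. *)
Record chart (R : realType) (T : Type) (n : nat) := Chart {
  chart_dom : set T;
  chart_fun : T -> Cn R n;
  chart_inv : Cn R n -> T }.

Definition is_chart (R : realType) (T : topologicalType) (n : nat)
    (c : chart R T n) : Prop :=
  [/\ open (chart_dom c),
      open (chart_fun c @` chart_dom c),
      forall x, chart_dom c x -> chart_inv c (chart_fun c x) = x,
      forall x, chart_dom c x -> {for x, continuous (chart_fun c)} &
      forall u, (chart_fun c @` chart_dom c) u -> {for u, continuous (chart_inv c)}].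

Definition transition (R : realType) (T : Type) (n : nat) (c c' : chart R T n) :
    Prop :=
  holomorphic_on (@mul_i R n) (@mul_i R n)
    (chart_fun c @` (chart_dom c `&` chart_dom c')) (chart_fun c' \o chart_inv c).

(* The tangent space T^(1,0) at [p] is identified with C^n through the preferred
   chart [chart_at p]: a row [a] stands for \sum_j a_j d/dw_j. *)
Record complex_manifold (R : realType) (n : nat) := ComplexManifold {
  point_of :> topologicalType;
  chart_at : point_of -> chart R point_of n;
  chart_atP : forall p, is_chart (chart_at p);
  mem_chart_at : forall p, chart_dom (chart_at p) p;
  transition_chart_at : forall p q, transition (chart_at p) (chart_at q);
  manifold_hausdorff : hausdorff_space point_of;
  manifold_second_countable : @second_countable point_of }.

Definition is_coordinate (R : realType) (n : nat) (M : complex_manifold R n)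
    (z : chart R M n) : Prop :=
  is_chart z /\
  forall p, transition z (chart_at p) /\ transition (chart_at p) z.

Definition loc_rep (R : realType) (m n : nat) (S T : Type) (c : chart R S m)
    (c' : chart R T n) (f : S -> T) : Cn R m -> Cn R n :=
  chart_fun c' \o f \o chart_inv c.

Definition loc_dom (R : realType) (m n : nat) (S T : Type) (W : set S)
    (c : chart R S m) (c' : chart R T n) (f : S -> T) : set (Cn R m) :=
  chart_fun c @` (W `&` chart_dom c `&` f @^-1` chart_dom c').

(* In the next three definitions [W] is open; a map defined on [W] is a total
   function whose values outside [W] are irrelevant. *)
Definition smooth_map (R : realType) (m n : nat) (M : complex_manifold R m)
    (N : complex_manifold R n) (W : set M) (f : M -> N) : Prop :=
  (forall p, W p -> {for p, continuous f}) /\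
  forall p q, smooth_on (loc_dom W (chart_at p) (chart_at q) f)
                        (loc_rep (chart_at p) (chart_at q) f).

Definition holomorphic_map (R : realType) (m n : nat) (M : complex_manifold R m)
    (N : complex_manifold R n) (W : set M) (f : M -> N) : Prop :=
  (forall p, W p -> {for p, continuous f}) /\
  forall p q, holomorphic_on (@mul_i R m) (@mul_i R n)
                             (loc_dom W (chart_at p) (chart_at q) f)
                             (loc_rep (chart_at p) (chart_at q) f).

Definition antiholomorphic_map (R : realType) (m n : nat)
    (M : complex_manifold R m) (N : complex_manifold R n) (W : set M)
    (f : M -> N) : Prop :=
  (forall p, W p -> {for p, continuous f}) /\
  forall p q, holomorphic_on (@mul_i R m) (fun w => - mul_i w)
                             (loc_dom W (chart_at p) (chart_at q) f)
                             (loc_rep (chart_at p) (chart_at q) f).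

(* f_* : T^(1,0)_p M -> T^(1,0)_(f p) N, for [f] holomorphic near [p]. *)
Definition tangent_map (R : realType) (m n : nat) (M : complex_manifold R m)
    (N : complex_manifold R n) (f : M -> N) (p : M) (x : 'rV[R[i]]_m) :
    'rV[R[i]]_n :=
  cplx ('D_(realv x) (loc_rep (chart_at p) (chart_at (f p)) f)
          (chart_fun (chart_at p) p)).

(* Elements of the complexified tangent space T^(1,0) (+) T^(0,1) of [N], as
   pairs of rows of coefficients of d/dw_j and of d/dwbar_j: f_* (d/dz) at [p]
   and f_* (d/dzbar) at [p], for [f] smooth. *)
Definition push_dz (R : realType) (n : nat) (M : complex_manifold R 1)
    (N : complex_manifold R n) (z : chart R M 1) (f : M -> N) (p : M) :
    'rV[R[i]]_n * 'rV[R[i]]_n :=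
  let F := loc_rep z (chart_at (f p)) f in
  (d_z F (chart_fun z p), d_z (@conj_vec R n \o F) (chart_fun z p)).

Definition push_dzbar (R : realType) (n : nat) (M : complex_manifold R 1)
    (N : complex_manifold R n) (z : chart R M 1) (f : M -> N) (p : M) :
    'rV[R[i]]_n * 'rV[R[i]]_n :=
  let F := loc_rep z (chart_at (f p)) f in
  (d_zbar F (chart_fun z p), d_zbar (@conj_vec R n \o F) (chart_fun z p)).

(** * Complex Lie groups *)

Record complex_lie_group (R : realType) (n : nat) := ComplexLieGroup {
  group_manifold :> complex_manifold R n;
  lone : group_manifold;
  lmul : group_manifold -> group_manifold -> group_manifold;
  linv : group_manifold -> group_manifold;
  lmulA : associative lmul;
  lmul1g : left_id lone lmul;
  lmulVg : left_inverse lone linv lmul;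
  lmul_continuous :
    continuous (fun a : group_manifold * group_manifold => lmul a.1 a.2);
  lmul_holomorphic : forall p q r : group_manifold,
    holomorphic_on (@mul_i2 R n n) (@mul_i R n)
      [set u : Cn R n * Cn R n |
        [/\ (chart_fun (chart_at p) @` chart_dom (chart_at p)) u.1,
            (chart_fun (chart_at q) @` chart_dom (chart_at q)) u.2 &
            chart_dom (chart_at r) (lmul (chart_inv (chart_at p) u.1)
                                         (chart_inv (chart_at q) u.2))]]
      (fun u => chart_fun (chart_at r)
                  (lmul (chart_inv (chart_at p) u.1) (chart_inv (chart_at q) u.2)));
  linv_holomorphic : holomorphic_map setT linv }.

Definition pt_mul (R : realType) (n : nat) (T : Type) (G : complex_lie_group R n)
    (f h : T -> G) : T -> G :=
  fun p => lmul (f p) (h p).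

Definition pt_inv (R : realType) (n : nat) (T : Type) (G : complex_lie_group R n)
    (f : T -> G) : T -> G :=
  fun p => linv (f p).

(* The Lie algebra of [G] is T^(1,0)_e G, that is ['rV[R[i]]_n] through the chart
   [chart_at (lone G)], with the bracket [lie_bracket] below. *)
Definition Ad (R : realType) (n : nat) (G : complex_lie_group R n) (g : G)
    (x : 'rV[R[i]]_n) : 'rV[R[i]]_n :=
  tangent_map (fun a : G => lmul (lmul g a) (linv g)) (lone G) x.

(* [x, y] is the derivative at e of g |-> Ad g y in the direction x. *)
Definition lie_bracket (R : realType) (n : nat) (G : complex_lie_group R n)
    (x y : 'rV[R[i]]_n) : 'rV[R[i]]_n :=
  let c := chart_at (lone G) in
  cplx ('D_(realv x) (fun u : Cn R n => realv (Ad (chart_inv c u) y))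
          (chart_fun c (lone G))).

Definition derived_algebra (R : realType) (n : nat) (G : complex_lie_group R n)
    (U : {vspace 'rV[R[i]]_n}) : {vspace 'rV[R[i]]_n} :=
  <<[seq lie_bracket G x y | x <- vbasis U, y <- vbasis U]>>%VS.

Definition is_solvable (R : realType) (n : nat) (G : complex_lie_group R n)
    (U : {vspace 'rV[R[i]]_n}) : Prop :=
  exists k, iter k (derived_algebra G) U = 0%VS.

Definition is_ideal (R : realType) (n : nat) (G : complex_lie_group R n)
    (U : {vspace 'rV[R[i]]_n}) : Prop :=
  forall x y, y \in U -> lie_bracket G x y \in U.

Definition semisimple (R : realType) (n : nat) (G : complex_lie_group R n) :
    Prop :=
  forall U : {vspace 'rV[R[i]]_n}, is_ideal G U -> is_solvable G U -> U = 0%VS.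

(** * Connected subgroups and homogeneous spaces *)

Definition one_parameter_subgroup (R : realType) (n : nat)
    (G : complex_lie_group R n) (c : R -> G) : Prop :=
  [/\ forall s t, c (s + t) = lmul (c s) (c t),
      continuous c &
      forall q, smooth_on (c @^-1` chart_dom (chart_at q) : set R^o)
                          (chart_fun (chart_at q) \o c : R^o -> Cn R n)].

Definition is_exp (R : realType) (n : nat) (G : complex_lie_group R n)
    (x : 'rV[R[i]]_n) (g : G) : Prop :=
  exists c : R -> G,
    [/\ one_parameter_subgroup c,
        'D_1 (chart_fun (chart_at (lone G)) \o c : R^o -> Cn R n) 0 = realv x &
        g = c 1].

Definition is_subgroup (R : realType) (n : nat) (G : complex_lie_group R n)
    (S : set G) : Prop :=
  [/\ S (lone G), forall g h, S g -> S h -> S (lmul g h) &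
      forall g, S g -> S (linv g)].

(* The connected subgroup with Lie algebra [a] is generated by exp(a). *)
Definition connected_subgroup (R : realType) (n : nat)
    (G : complex_lie_group R n) (a : set 'rV[R[i]]_n) : set G :=
  smallest (@is_subgroup R n G) [set g | exists2 x, a x & is_exp x g].

Arguments connected_subgroup {R n} G a.

(* [pi : G -> F] realizes the quotient manifold of left cosets G/B: this
   determines the complex manifold [F] up to a unique isomorphism over [G]. *)
Definition is_quotient_manifold (R : realType) (n k : nat)
    (G : complex_lie_group R n) (B : set G) (F : complex_manifold R k)
    (pi : G -> F) : Prop :=
  [/\ holomorphic_map setT pi,
      forall y, exists g, pi g = y,
      forall g h, pi g = pi h <-> B (lmul (linv g) h) &
      forall (g : G) (y : 'rV[R[i]]_k), exists x, tangent_map pi g x = y].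

(** * Gradations *)

Definition is_gradation (R : realType) (n : nat) (G : complex_lie_group R n)
    (gr : int -> {vspace 'rV[R[i]]_n}) : Prop :=
  [/\ forall s : seq int, uniq s -> directv (\sum_(m <- s) gr m)%VS,
      exists s : seq int, (\sum_(m <- s) gr m)%VS = fullv &
      forall k l x y, x \in gr k -> y \in gr l ->
        lie_bracket G x y \in gr (k + l)].

(* The sum of the [gr m] over all [m] satisfying [P]. *)
Definition graded_part (R : realType) (n : nat)
    (gr : int -> {vspace 'rV[R[i]]_n}) (P : pred int) : set 'rV[R[i]]_n :=
  [set x | exists2 s : seq int, all P s & x \in (\sum_(m <- s) gr m)%VS].

Definition Hsub (R : realType) (n : nat) (G : complex_lie_group R n)
    (gr : int -> {vspace 'rV[R[i]]_n}) : set G :=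
  connected_subgroup G (graded_part gr (fun m => m == 0)).

Definition Nminus (R : realType) (n : nat) (G : complex_lie_group R n)
    (gr : int -> {vspace 'rV[R[i]]_n}) : set G :=
  connected_subgroup G (graded_part gr (fun m => m < 0)).

Definition Nplus (R : realType) (n : nat) (G : complex_lie_group R n)
    (gr : int -> {vspace 'rV[R[i]]_n}) : set G :=
  connected_subgroup G (graded_part gr (fun m => 0 < m)).

Definition Bminus (R : realType) (n : nat) (G : complex_lie_group R n)
    (gr : int -> {vspace 'rV[R[i]]_n}) : set G :=
  connected_subgroup G (graded_part gr (fun m => m <= 0)).

Definition Bplus (R : realType) (n : nat) (G : complex_lie_group R n)
    (gr : int -> {vspace 'rV[R[i]]_n}) : set G :=
  connected_subgroup G (graded_part gr (fun m => 0 <= m)).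

Arguments Hsub {R n} G gr.
Arguments Nminus {R n} G gr.
Arguments Nplus {R n} G gr.
Arguments Bminus {R n} G gr.
Arguments Bplus {R n} G gr.

(** * The Maurer-Cartan form and admissible mappings *)

(* The value of theta at [g] on a vector of T^(1,0)_g G. *)
Definition maurer_cartan (R : realType) (n : nat) (G : complex_lie_group R n)
    (g : G) (x : 'rV[R[i]]_n) : 'rV[R[i]]_n :=
  tangent_map (lmul (linv g)) g x.

(* phi^* theta = omega_minus dz + omega_plus dzbar; being of type (1,0), theta
   only sees the T^(1,0) components of phi_* (d/dz) and phi_* (d/dzbar). *)
Definition omega_minus (R : realType) (n : nat) (M : complex_manifold R 1)
    (G : complex_lie_group R n) (z : chart R M 1) (phi : M -> G) (p : M) :
    'rV[R[i]]_n :=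
  maurer_cartan (phi p) (push_dz z phi p).1.

Definition omega_plus (R : realType) (n : nat) (M : complex_manifold R 1)
    (G : complex_lie_group R n) (z : chart R M 1) (phi : M -> G) (p : M) :
    'rV[R[i]]_n :=
  maurer_cartan (phi p) (push_dzbar z phi p).1.

Definition orbit_Ad (R : realType) (n : nat) (G : complex_lie_group R n)
    (H : set G) (x : 'rV[R[i]]_n) : set 'rV[R[i]]_n :=
  [set Ad h x | h in H].

Definition orbit_at (R : realType) (n : nat) (G : complex_lie_group R n)
    (H : set G) (x : 'rV[R[i]]_n) (g : G) : set 'rV[R[i]]_n :=
  [set tangent_map (lmul g) (lone G) y | y in orbit_Ad H x].

Definition admissible (R : realType) (M : complex_manifold R 1) (n : nat)
    (G : complex_lie_group R n) (gr : int -> {vspace 'rV[R[i]]_n})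
    (xm xp : 'rV[R[i]]_n) (km kp : nat)
    (Fm : complex_manifold R km) (Fp : complex_manifold R kp)
    (pim : G -> Fm) (pip : G -> Fp) (phi : M -> G) : Prop :=
  forall (z : chart R M 1) (p : M), is_coordinate z -> chart_dom z p ->
    [/\ omega_minus z phi p \in (gr (-1)%R + gr 0%R)%VS,
        omega_plus z phi p \in (gr 0%R + gr 1%R)%VS,
        forall g : G, pim g = pim (phi p) ->
          exists2 x, orbit_at (Hsub G gr) xm g x &
            push_dz z (pim \o phi) p = (tangent_map pim g x, 0) &
        forall g : G, pip g = pip (phi p) ->
          exists2 x, orbit_at (Hsub G gr) xp g x &
            push_dzbar z (pip \o phi) p = (tangent_map pip g x, 0)].

Definition smooth_into (R : realType) (n : nat) (M : complex_manifold R 1)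
    (G : complex_lie_group R n) (W : set M) (S : set G) (f : M -> G) : Prop :=
  smooth_map W f /\ forall p, W p -> S (f p).

(* Main.v *)
(* Write Om for either component of the pull-back of the Maurer-Cartan form, so
   that Om(f h) = Ad(h^-1) Om f + Om h.  In phi = mu_+ nu_- eta_-, the (1,0)
   component of mu_+ lies in n_+, while admissibility puts that of phi in
   g_-1 + g_0; this forces the former to vanish, and Om phi - Om eta_- lies in
   n_-.  In phi = mu_- nu_+ eta_+, the part of lowest degree of Om phi is
   Ad(eta_+^-1) lambda_-.  Hence Om phi = Ad(eta_+^-1) lambda_- + Om eta_- for the
   (1,0) components and, symmetrically, Om phi = Ad(eta_-^-1) lambda_+ + Om eta_+
   for the (0,1) components.  For psi = eta_+^-1 gamma_- one has
   eta_- psi = gamma_+ gamma and eta_+ psi = gamma_-, and the (anti)holomorphy of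
   gamma_+ and gamma_- removes the remaining terms.

   The velocity of a curve in N_-, N_+ or H lies in n_-, n_+ or g_0: by uniqueness
   for linear differential equations, Ad of exp x raises degrees as ad x does,
   hence so does Ad on the whole subgroup, and therefore also ad X for a velocity
   X; since G has trivial centre, X is determined by ad X, degree by degree. *)

Require Import Defs.
From HB Require Import structures.
From mathcomp Require Import all_boot all_order all_algebra.
From mathcomp Require Import all_classical all_reals all_analysis.
From mathcomp Require Import complex.
From mathcomp Require Import zify.

Set Implicit Arguments.
Unset Strict Implicit.
Unset Printing Implicit Defensive.

Import Order.TTheory GRing.Theory Num.Theory.
Import numFieldNormedType.Exports.

Local Open Scope classical_set_scope.
Local Open Scope ring_scope.

(** * Differential calculus *)

(** The connected subgroups are bare sets generated by exponentials, with no manifold structure of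
    their own, and smoothness of a map into one of them only means smoothness into [G]. Its velocity
    therefore cannot be read off in charts of the subgroup. This is why membership is replaced by a
    condition on [Ad]: it is stable under products, so it passes from generators to the whole
    subgroup, and a derivative inherits it because it confines [Ad] to fixed linear subspaces. The
    series for Ad of exp x is avoided, since confinement only requires that a linear equation with
    constant coefficients and zero initial value has the zero solution.

    All calculus is real. Complex linearity of [Ad], of the Maurer-Cartan form and of the bracket
    has to be recovered from Cauchy-Riemann equations. The bracket in its first argument is the
    delicate case: it is a mixed second derivative of conjugation, and the equations apply to it
    only after the order of differentiation is exchanged, whence the symmetry of second derivatives
    below. *)

Section Differentials.
Variables (R : realType).
Implicit Types (V W X : normedModType R).

Lemma near_differentiable V W (f g : V -> W) p :
  (\near p, f p = g p) -> differentiable f p -> differentiable g p.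
Proof.
move=> fg /diff_locallyP [df_cont fE].
have gE : g \o shift p = cst (g p) + 'd f p +o_ (0 : V) id.
  apply/eqaddoP => e e0; move/eqaddoP: fE => /(_ e e0) fE'.
  have fgp : f p = g p by exact: nbhs_singleton fg.
  have fg0 := fg; rewrite (near_shift 0) /= subr0 in fg0.
  by apply: filterS2 fE' fg0 => x; rewrite !fctE /= => + <-; rewrite -fgp.
apply/diff_locallyP; have -> // := diff_unique df_cont gE.
Qed.

Lemma eq_derive V W (f g : V -> W) p v : f =1 g -> 'D_v f p = 'D_v g p.
Proof. by move=> /funext ->. Qed.

Lemma derive_comp V W X (f : V -> W) (g : W -> X) p v :
  differentiable f p -> differentiable g (f p) ->
  'D_v (g \o f) p = 'D_('D_v f p) g (f p).
Proof.
move=> df dg.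
have dgf := differentiable_comp df dg.
by rewrite (deriveE _ dgf) (deriveE _ dg) (deriveE _ df) (diff_comp df dg).
Qed.

Lemma derive_pair V W X (f : V -> W) (g : V -> X) p v :
  differentiable f p -> differentiable g p ->
  'D_v (fun x => (f x, g x)) p = ('D_v f p, 'D_v g p).
Proof.
move=> df dg.
have dfg := differentiable_pair df dg.
by rewrite (deriveE _ dfg) (deriveE _ dg) (deriveE _ df) (diff_pair df dg).
Qed.

Lemma derive_lin V W (L : {linear V -> W}) p v :
  continuous L -> 'D_v L p = L v.
Proof.
move=> cL; rewrite deriveE ?diff_lin //; exact: linear_differentiable.
Qed.

Lemma derive_lin_comp V W X (L : {linear W -> X}) (f : V -> W) p v :
  continuous L -> differentiable f p -> 'D_v (L \o f) p = L ('D_v f p).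
Proof.
move=> cL df; rewrite derive_comp ?derive_lin //; exact: linear_differentiable.
Qed.

Lemma derive_add_dir V W (f : V -> W) p u v :
  differentiable f p -> 'D_(u + v) f p = 'D_u f p + 'D_v f p.
Proof. by move=> df; rewrite !deriveE // linearD. Qed.

Lemma derive_scale_dir V W (f : V -> W) p a v :
  differentiable f p -> 'D_(a *: v) f p = a *: 'D_v f p.
Proof. by move=> df; rewrite !deriveE // linearZ. Qed.

End Differentials.

(** * Calculus of C^k maps, symmetry of second derivatives, and linear differential equations *)

Section CkCalculus.
Variables (R : realType).
Implicit Types (V W X : normedModType R).

Lemma CkS V W k (U : set V) (f : V -> W) : Ck k.+1 U f <->
  (forall p, U p -> differentiable f p) /\ (forall v, Ck k U ('D_v f)).
Proof. by []. Qed.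

(** Openness of [U] turns equality on [U] into equality near each of its points, which is what
    derivatives see. *)
Lemma Ck_ext V W k (U : set V) (f g : V -> W) :
  open U -> {in U, f =1 g} -> Ck k U f -> Ck k U g.
Proof.
move=> Uo; elim: k f g => [|k IH] f g fg /=.
  move=> cf p Up; have nfg : \near p, f p = g p.
    by near=> q; apply: fg; rewrite inE; near: q; exact: open_nbhs_nbhs.
  rewrite /prop_for /continuous_at -(nbhs_singleton nfg).
  apply: cvg_trans (cf p Up); apply: near_eq_cvg; by apply: filterS nfg => q ->.
have nfg p : U p -> \near p, f p = g p.
  by move=> Up; near=> q; apply: fg; rewrite inE; near: q; exact: open_nbhs_nbhs.
move=> [df cf]; split=> [p Up|v].
  exact: near_differentiable (nfg p Up) (df p Up).
by apply: IH (cf v) => p; rewrite inE => Up; apply: near_eq_derive; exact: nfg.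
Unshelve. all: by end_near. Qed.

Lemma Ck_sub V W k (U U' : set V) (f : V -> W) :
  U' `<=` U -> Ck k U f -> Ck k U' f.
Proof.
move=> sU; elim: k f => [|k IH] f /=; first by move=> cf p /sU /cf.
by move=> [df cf]; split=> [p /sU /df //|v]; exact: IH.
Qed.

Lemma Ck_local V W k (U : set V) (f : V -> W) :
  (forall p, U p -> exists2 U', U' p & Ck k U' f) -> Ck k U f.
Proof.
elim: k f => [|k IH] f /= loc; first by move=> p /loc [U' U'p cf]; exact: cf.
split=> [p /loc [U' U'p [df _]]|v]; first exact: df.
by apply: IH => p /loc [U' U'p [_ cf]]; exists U'.
Qed.

Lemma CkW V W k (U : set V) (f : V -> W) : Ck k.+1 U f -> Ck k U f.
Proof.
elim: k f => [|k IH] f.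
  by move=> [df _] p Up; exact/differentiable_continuous/df.
by move=> [df cf]; split=> // v; exact: IH.
Qed.

Lemma Ck_cst V W k (U : set V) (a : W) : Ck k U (fun=> a).
Proof.
elim: k a => [|k IH] a /=; first by move=> p _; exact: cst_continuous.
split=> [p _|v]; first exact: differentiable_cst.
have -> : 'D_v (fun=> a) = (fun=> 0) :> (V -> W) by apply/funext => p; exact: derive_cst.
exact: IH.
Qed.

Lemma Ck_linear V W k (U : set V) (L : {linear V -> W}) :
  continuous L -> Ck k U L.
Proof.
move=> cL; case: k => [|k] /=; first by move=> p _; exact: cL.
split=> [p _|v]; first exact: linear_differentiable.
have -> : 'D_v L = (fun=> L v) :> (V -> W) by apply/funext => p; exact: derive_lin.
exact: Ck_cst.
Qed.

Lemma Ck_add V W k (U : set V) (f g : V -> W) : open U ->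
  Ck k U f -> Ck k U g -> Ck k U (fun p => f p + g p).
Proof.
move=> Uo; elim: k f g => [|k IH] f g /=.
  by move=> cf cg p Up; apply: continuousD; [exact: cf|exact: cg].
move=> [df cf] [dg cg]; split=> [p Up|v].
  by apply: differentiableD; [exact: df|exact: dg].
apply: (@Ck_ext _ _ k U (fun p => 'D_v f p + 'D_v g p)) => //; last exact: IH.
move=> p; rewrite inE => Up; symmetry; apply: deriveD; apply: diff_derivable.
  exact: df.
exact: dg.
Qed.

Lemma Ck_sum V W k (U : set V) (I : Type) (r : seq I) (F : I -> V -> W) : open U ->
  (forall i, Ck k U (F i)) -> Ck k U (fun p => \sum_(i <- r) F i p).
Proof.
move=> Uo cF; elim: r => [|i r IH].
  by under eq_fun do rewrite big_nil; exact: Ck_cst.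
by under eq_fun do rewrite big_cons; exact: Ck_add.
Qed.

Lemma Ck_linear_comp V W X k (U : set V) (L : {linear W -> X}) (f : V -> W) :
  open U -> continuous L -> Ck k U f -> Ck k U (L \o f).
Proof.
move=> Uo cL; elim: k f => [|k IH] f /=.
  by move=> cf p Up; apply: continuous_comp; [exact: cf|exact: cL].
move=> [df cf]; split=> [p Up|v].
  by apply: differentiable_comp; [exact: df|exact: linear_differentiable].
apply: (@Ck_ext _ _ k U (L \o 'D_v f)) => //; last exact: IH.
by move=> p; rewrite inE => Up /=; rewrite derive_lin_comp //; exact: df.
Qed.

Lemma scaler_is_bilinear W : bilinear_for
    (GRing.Scale.Law.clone _ _ *:%R _) (GRing.Scale.Law.clone _ _ *:%R _)
    (fun (a : R^o) (w : W) => a *: w).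
Proof.
split=> [w|a] b x y /=; first by rewrite scalerDl scalerA.
by rewrite scalerDr !scalerA mulrC.
Qed.

Lemma is_diff_scale V W (f : V -> R^o) (g : V -> W) p :
  differentiable f p -> differentiable g p ->
  is_diff p (fun q => f q *: g q) (fun v => f p *: 'd g p v + 'd f p v *: g p).
Proof.
move=> df dg.
pose s : {bilinear R^o -> W -> W} := HB.pack (fun (a : R^o) (w : W) => a *: w)
  (@bilinear_isBilinear.Build R R^o W W _ _ _ (@scaler_is_bilinear W)).
have cs : continuous (fun q : R^o * W => s q.1 q.2).
  by move=> q; apply: continuousZ; [exact: cvg_fst|exact: cvg_snd].
have dp := differentiable_pair df dg.
have ds := @differentiable_bilin _ _ _ _ s (f p, g p) cs.
have -> : (fun q => f q *: g q) = (fun q : R^o * W => s q.1 q.2) \o (fun q => (f q, g q)).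
  by [].
apply: DiffDef; first exact: differentiable_comp.
by apply/funext => v; rewrite diff_comp //= (diff_bilin (f p, g p) cs) diff_pair.
Qed.

Lemma differentiable_scale V W (f : V -> R^o) (g : V -> W) p :
  differentiable f p -> differentiable g p ->
  differentiable (fun q => f q *: g q) p.
Proof. by move=> df dg; case: (is_diff_scale df dg). Qed.

Lemma derive_scale V W (f : V -> R^o) (g : V -> W) p v :
  differentiable f p -> differentiable g p ->
  'D_v (fun q => f q *: g q) p = f p *: 'D_v g p + 'D_v f p *: g p.
Proof.
move=> df dg; rewrite !deriveE //; last exact: differentiable_scale.
by have [_ ->] := is_diff_scale df dg.
Qed.

Lemma Ck_scale V W k (U : set V) (f : V -> R^o) (g : V -> W) : open U ->
  Ck k U f -> Ck k U g -> Ck k U (fun p => f p *: g p).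
Proof.
move=> Uo; elim: k f g => [|k IH] f g.
  by move=> cf cg p Up; apply: continuousZ; [exact: cf|exact: cg].
move=> ckf ckg; have [cf cg] := (CkW ckf, CkW ckg).
move: ckf ckg => /CkS [df ckf] /CkS [dg ckg]; split=> [p Up|v].
  by apply: differentiable_scale; [exact: df|exact: dg].
apply: (@Ck_ext _ _ k U (fun p => f p *: 'D_v g p + 'D_v f p *: g p)) => //.
  by move=> p; rewrite inE => Up; rewrite derive_scale //; [exact: df|exact: dg].
by apply: Ck_add => //; apply: IH.
Qed.

Lemma Ck_pair V W X k (U : set V) (f : V -> W) (g : V -> X) : open U ->
  Ck k U f -> Ck k U g -> Ck k U (fun p => (f p, g p)).
Proof.
move=> Uo; elim: k f g => [|k IH] f g /=.
  by move=> cf cg p Up; apply: cvg_pair; [exact: cf|exact: cg].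
move=> [df cf] [dg cg]; split=> [p Up|v].
  by apply: differentiable_pair; [exact: df|exact: dg].
apply: (@Ck_ext _ _ k U (fun p => ('D_v f p, 'D_v g p))) => //; last exact: IH.
by move=> p; rewrite inE => Up; rewrite derive_pair //; [exact: df|exact: dg].
Qed.

(** Finite dimensionality with continuous coordinates, without independence of the [e i]. It allows
    a derivative in a varying direction to be expanded in fixed directions, and vector statements to
    be reduced to scalar ones. *)
Definition finite_coordinates W :=
  exists (I : finType) (e : I -> W) (c : I -> {linear W -> R^o}),
    (forall i, continuous (c i)) /\ forall w, w = \sum_i c i w *: e i.

Lemma finite_coordinates_pair V W :
  finite_coordinates V -> finite_coordinates W -> finite_coordinates (V * W)%type.
Proof.
move=> [I [e [c [cc ce]]]] [J [e' [c' [cc' ce']]]].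
exists (I + J)%type, (fun s : (I + J)%type => match s with inl i => (e i, 0) | inr j => (0, e' j) end).
exists (fun s : (I + J)%type => match s with
  | inl i => (c i \o (fst : (V * W)%type -> V)) : {linear (V * W)%type -> R^o}
  | inr j => (c' j \o (snd : (V * W)%type -> W)) : {linear (V * W)%type -> R^o} end); split.
  case=> i p; apply: continuous_comp; [exact: cvg_fst|exact: cc|exact: cvg_snd|exact: cc'].
move=> [v w]; rewrite big_sumType /=; apply: injective_projections.
  rewrite raddfD /= !raddf_sum /= [X in _ + X]big1 => [|j _]; last exact: scaler0.
  by rewrite addr0 [LHS]ce.
rewrite raddfD /= !raddf_sum /= [X in X + _]big1 => [|j _]; last exact: scaler0.
by rewrite add0r [LHS]ce'.
Qed.

Lemma finite_coordinates_rV n : finite_coordinates 'rV[R]_n.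
Proof.
have coord_lin j : linear (fun v : 'rV[R]_n => v 0 j : R^o) by move=> a u v; rewrite !mxE.
pose c j : {linear 'rV[R]_n -> R^o} := HB.pack (fun v : 'rV[R]_n => v 0 j : R^o)
  (GRing.isLinear.Build _ _ _ _ _ (coord_lin j)).
exists 'I_n, (fun j => delta_mx 0 j), c; split=> [j|v]; last exact: row_sum_delta.
exact: coord_continuous.
Qed.

Lemma finite_coordinates_Cn n : finite_coordinates (Cn R n).
Proof. apply: finite_coordinates_pair; exact: finite_coordinates_rV. Qed.

Lemma continuous_linear_fin V W (L : {linear V -> W}) :
  finite_coordinates V -> continuous L.
Proof.
move=> [I [e [c [cc ce]]]] p.
have -> : (L : V -> W) = fun p => \sum_i c i p *: L (e i).
  by apply/funext => q; rewrite [in LHS](ce q) linear_sum; under eq_bigr do rewrite linearZ.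
apply: (@Ck_sum V W 0 setT) => // [|i q _]; first exact: openT.
apply: continuousZ; [exact: cc|exact: cst_continuous].
Qed.

(** The chain rule differentiates [g] in the direction ['D_v f p], which moves with [p], whereas
    [Ck] speaks of fixed directions. Expanding it in coordinates gives a sum of scalar functions
    times ['D_(e i) g \o f], to which the induction hypothesis applies. *)
Lemma Ck_comp V W X k (U : set V) (U' : set W) (f : V -> W) (g : W -> X) :
  finite_coordinates W -> open U -> (forall p, U p -> U' (f p)) ->
  Ck k U f -> Ck k U' g -> Ck k U (g \o f).
Proof.
move=> [I [e [c [cc ce]]]] Uo fU; elim: k f g fU => [|k IH] f g fU.
  by move=> cf cg p Up; apply: continuous_comp; [exact: cf|exact/cg/fU].
move=> ckf ckg; have cf := CkW ckf; move: ckf ckg => /CkS [df ckf] /CkS [dg ckg].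
split=> [p Up|v]; first by apply: differentiable_comp; [exact: df|exact/dg/fU].
apply: (@Ck_ext _ _ k U (fun p => \sum_i c i ('D_v f p) *: 'D_(e i) g (f p))) => //.
  move=> p; rewrite inE => Up; rewrite derive_comp; [|exact: df|exact/dg/fU].
  have dgp := dg _ (fU _ Up); rewrite [in RHS](ce ('D_v f p)) (deriveE _ dgp).
  by rewrite linear_sum; apply: eq_bigr => i _; rewrite linearZ (deriveE _ dgp).
apply: Ck_sum => // i; apply: Ck_scale => //.
  exact: (Ck_linear_comp Uo (cc i) (ckf v)).
exact: (IH f ('D_(e i) g)).
Qed.


Lemma derive_line V W (f : V -> W) q v (s : R) :
  differentiable f (q + s *: v) ->
  is_derive s 1 ((fun s : R => f (q + s *: v)) : R^o -> W) ('D_v f (q + s *: v)).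
Proof.
move=> df; pose l (s : R^o) := q + s *: v.
have dl : differentiable l s.
  by apply: differentiableD; [exact: differentiable_cst|exact: differentiableZl].
have -> : (fun s : R => f (q + s *: v)) = f \o l by [].
apply: DeriveDef; first by apply: diff_derivable; exact: differentiable_comp.
rewrite derive_comp //; congr ('D__ f _).
have L_lin : linear (fun s : R^o => s *: v) by move=> a x y; rewrite scalerDl scalerA.
pose L : {linear R^o -> V} := HB.pack (fun s : R^o => s *: v)
  (GRing.isLinear.Build _ _ _ _ _ L_lin).
have cL : continuous L by move=> x; apply: continuousZ; [exact: cvg_id|exact: cst_continuous].
have dL : derivable L s 1 by apply: diff_derivable; exact: linear_differentiable.
rewrite (_ : l = cst q + L) // deriveD ?derive_cst ?add0r ?derive_lin //=.
by rewrite scale1r.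
Qed.

Lemma mean_value_line V (f : V -> R^o) q v (h : R) : 0 < h ->
  (forall s, 0 <= s <= h -> differentiable f (q + s *: v)) ->
  exists2 c, 0 < c < h & f (q + h *: v) - f q = h * 'D_v f (q + c *: v).
Proof.
move=> h0 df; pose g (s : R) : R := f (q + s *: v).
have dg s : 0 <= s <= h -> is_derive s 1 g ('D_v f (q + s *: v)).
  by move=> /df; exact: derive_line.
have [| |c ch] := @MVT R g (fun s => 'D_v f (q + s *: v)) 0 h h0.
- by move=> s; rewrite in_itv /= => /andP[s0 sh]; apply: dg; rewrite !ltW.
- apply: derivable_within_continuous => s; rewrite in_itv /= => sh.
  by have [] := dg s sh.
rewrite /g scale0r addr0 subr0 mulrC => ->; exists c => //.
Qed.

Lemma differentiable_translate V W (f : V -> W) a p :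
  differentiable f (p + a) -> differentiable (fun x => f (x + a)) p.
Proof.
move=> df; apply: (@differentiable_comp _ _ _ _ (fun x => x + a) f) => //.
Qed.

Lemma derive_translate V W (f : V -> W) a p v :
  'D_v (fun x => f (x + a)) p = 'D_v f (p + a).
Proof. by rewrite /derive; under eq_fun do rewrite /= -addrA. Qed.

(** Mean value theorem twice: along [v] for the increment of [f] by [h *: w], then along [w] for
    ['D_v f]. The closed parallelogram has to lie in [U] so that both segments do, endpoints
    included. *)
Lemma second_difference V (U : set V) (f : V -> R^o) p v w (h : R) :
  0 < h -> Ck 2 U f ->
  (forall c d, 0 <= c <= h -> 0 <= d <= h -> U (p + c *: v + d *: w)) ->
  exists c d, [/\ 0 <= c <= h, 0 <= d <= h &
    f (p + h *: v + h *: w) - f (p + h *: v) - (f (p + h *: w) - f p) =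
    h * (h * 'D_w ('D_v f) (p + c *: v + d *: w))].
Proof.
move=> h0 /CkS [df cf] inU; have /CkS [ddf _] := cf v.
have hh : 0 <= h <= h by rewrite ltW //=.
have h00 : 0 <= (0 : R) <= h by rewrite lexx ltW.
pose F (x : V) : R^o := f (x + h *: w) - f x.
have dF1 s : 0 <= s <= h -> differentiable (fun x => f (x + h *: w)) (p + s *: v).
  by move=> sh; apply: differentiable_translate; apply: df; exact: inU.
have dF2 s : 0 <= s <= h -> differentiable f (p + s *: v).
  by move=> sh; apply: df; have := inU s 0 sh h00; rewrite scale0r addr0.
have [s sh|c ch] := @mean_value_line _ F p v h h0.
  by apply: differentiableB; [exact: dF1|exact: dF2].
have ch' : 0 <= c <= h by case/andP: ch => *; rewrite !ltW.
have DF : 'D_v F (p + c *: v) = 'D_v f (p + c *: v + h *: w) - 'D_v f (p + c *: v).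
  rewrite deriveB; [|by apply: diff_derivable; exact: dF1|by apply: diff_derivable; exact: dF2].
  by rewrite derive_translate.
rewrite DF => DE.
have [s sh|d dh DE'] := @mean_value_line _ ('D_v f) (p + c *: v) w h h0.
  by apply: ddf; exact: inU.
have dh' : 0 <= d <= h by case/andP: dh => *; rewrite !ltW.
by exists c, d; split; rewrite // -DE' -DE /F.
Qed.

Lemma small_parallelogram V (N : set V) p v w : nbhs p N ->
  exists2 h : R, 0 < h &
    forall c d, 0 <= c <= h -> 0 <= d <= h -> N (p + c *: v + d *: w).
Proof.
move=> /nbhs_normP [e /= e0 eN]; have k0 : 0 < `|v| + `|w| + 1 by rewrite ltr_wpDl ?addr_ge0.
exists (e / (`|v| + `|w| + 1)); first exact: divr_gt0.
move=> c d /andP[c0 ch] /andP[d0 dh]; apply: eN => /=.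
rewrite -addrA opprD addrA subrr add0r normrN.
apply: (@le_lt_trans _ _ (e / (`|v| + `|w| + 1) * (`|v| + `|w|))).
  rewrite mulrDr; apply: le_trans (ler_normD _ _) _; rewrite !normrZ !ger0_norm //.
  by apply: lerD; rewrite ler_wpM2r.
by rewrite mulrAC ltr_pdivrMr // ltr_pM2l // ltrDl.
Qed.

Lemma sub4C (Z : zmodType) (a b c d : Z) : a - b - (c - d) = a - c - (b - d).
Proof. by rewrite !opprB !addrA addrAC [RHS]addrAC [a - b - c]addrAC. Qed.

Lemma close_dist_le (a b x e : R) :
  `|a - x| < e / 2 -> `|b - x| < e / 2 -> `|a - b| <= e.
Proof.
move=> ax bx; rewrite -(subrK x a) -addrA -[x - b]opprB.
apply: le_trans (ler_normB _ _) _; rewrite [leRHS]splitr; apply: lerD; exact: ltW.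
Qed.

(** The second difference is symmetric in [v] and [w]. Computed in either order, it is h^2 times a
    mixed derivative at some point of a small parallelogram; so the two mixed derivatives coincide
    at two points close to [p], and continuity makes their values at [p] differ by at most any
    [e]. *)
Lemma derive_swap_scalar V (U : set V) (f : V -> R^o) p v w :
  open U -> Ck 2 U f -> U p -> 'D_v ('D_w f) p = 'D_w ('D_v f) p.
Proof.
move=> Uo cf Up; have /CkS [_ df] := cf.
have cvw x y : {for p, continuous ('D_x ('D_y f))} by have /CkS [_ /(_ x) /(_ p Up)] := df y.
apply/eqP; rewrite -subr_eq0 -normr_le0; apply/ler_addgt0Pl => e e0; rewrite addr0.
have e20 : 0 < e / 2 by rewrite divr_gt0.
have near_ball x y : nbhs p [set q | `|'D_x ('D_y f) p - 'D_x ('D_y f) q| < e / 2].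
  by move/cvgrPdist_lt : (cvw x y) => /(_ _ e20).
have UN : nbhs p U by exact: open_nbhs_nbhs.
have [h h0 hN] := small_parallelogram v w (filterI UN (filterI (near_ball v w) (near_ball w v))).
have [c [d [ch dh E1]]] := second_difference (v := v) (w := w) h0 cf (fun c d ch dh => (hN c d ch dh).1).
have [|d' [c' [dh' ch' E2]]] := @second_difference _ U f p w v h h0 cf.
  by move=> d' c' dh' ch'; rewrite addrAC; exact: (hN _ _ _ _).1.
have E : 'D_w ('D_v f) (p + c *: v + d *: w) = 'D_v ('D_w f) (p + d' *: w + c' *: v).
  have hn : h != 0 by rewrite gt_eqF.
  rewrite (addrAC p (h *: w)) in E2; apply: (mulfI hn); apply: (mulfI hn).
  exact: etrans (esym E1) (etrans (sub4C _ _ _ _) E2).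
have [_ [_ N1]] := hN _ _ ch dh; have [_ [N2 _]] := hN _ _ ch' dh'.
rewrite addrAC in N2; rewrite /= -E in N2; exact: close_dist_le N2 N1.
Qed.

(** The mean value theorem is scalar, hence the passage through coordinates. *)
Lemma derive_swap V W (U : set V) (f : V -> W) p v w : finite_coordinates W ->
  open U -> Ck 2 U f -> U p -> 'D_v ('D_w f) p = 'D_w ('D_v f) p.
Proof.
move=> [I [e [c [cc ce]]]] Uo cf Up; rewrite [LHS]ce [RHS]ce; apply: eq_bigr => i _.
congr (_ *: _); have /CkS [df ddf] := cf.
have Dc x : {in U, 'D_x (c i \o f) =1 c i \o 'D_x f}.
  by move=> q; rewrite inE => Uq /=; rewrite derive_lin_comp //; exact: df.
have DDc x y : 'D_x ('D_y (c i \o f)) p = c i ('D_x ('D_y f) p).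
  rewrite -derive_lin_comp //; last by have /CkS [/(_ p Up)] := ddf y.
  apply: near_eq_derive; near=> q; apply: Dc; rewrite inE; near: q.
  exact: open_nbhs_nbhs.
rewrite -!DDc; apply: (derive_swap_scalar _ _ Uo _ Up); exact: (Ck_linear_comp Uo (cc i) cf).
Unshelve. all: by end_near. Qed.

(** Gronwall's argument for the energy [S], the sum of the squares. *)
Lemma linear_ode_scalar (I : finType) (u : I -> R -> R) (b : I -> I -> R) :
  (forall i (t : R), is_derive t 1 (u i) (\sum_j b i j * u j t)) ->
  (forall i, u i 0 = 0) -> forall i, u i 1 = 0.
Proof.
move=> du u0; pose beta : R := \sum_i \sum_j `|b i j|.
pose S (t : R) : R := \sum_i u i t ^+ 2; pose dS (t : R) : R := \sum_i 2 * u i t * (\sum_j b i j * u j t).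
(* Every product [u i t * u j t] is bounded by [S t], and each term of [dS] carries a factor 2. *)
pose K : R := beta *+ 2.
have S_derive (t : R) : is_derive t 1 S (dS t).
  have gen r : is_derive t 1 (fun t : R => \sum_(i <- r) u i t ^+ 2 : R)
      (\sum_(i <- r) 2 * u i t * (\sum_j b i j * u j t)); last exact: gen.
  elim: r => [|i r IH].
    rewrite (_ : (fun t => _) = cst 0); last by apply/funext => x; rewrite big_nil.
    by rewrite big_nil; exact: is_derive_cst.
  rewrite (_ : (fun t => _) = u i * u i + (fun t : R => \sum_(j <- r) u j t ^+ 2)); last first.
    by apply/funext => x; rewrite big_cons expr2.
  rewrite big_cons; apply: is_deriveD.
  have := is_deriveM (du i t) (du i t) => /is_derive_eq; apply.
  by rewrite /GRing.scale /= -mulr2n -mulrA mulr_natl.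
have u_le i t : u i t ^+ 2 <= S t.
  by rewrite /S (bigD1 i) //= lerDl sumr_ge0 // => j _; exact: sqr_ge0.
have dS_le t : dS t <= K * S t.
  rewrite /dS /K mulrnAl mulr_suml -sumrMnl; apply: ler_sum => i _.
  rewrite mulr_suml -sumrMnl mulr_sumr; apply: ler_sum => j _.
  rewrite -mulrA mulr_natl lerMn2r /=.
  apply: le_trans (ler_norm _) _; rewrite mulrCA normrM; apply: ler_wpM2l => //.
  apply: (@le_trans _ _ ((u i t ^+ 2 + u j t ^+ 2) / 2)); last first.
    by rewrite ler_pdivrMr // mulr_natr mulr2n lerD.
  rewrite ler_pdivlMr // normrM -[u i t ^+ 2]real_normK ?num_real //.
  rewrite -[u j t ^+ 2]real_normK ?num_real //.
  have := sqr_ge0 (`|u i t| - `|u j t|).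
  by rewrite sqrrB mulr_natr addrAC subr_ge0.
(* The derivative of [S] is at most [K * S], so [h] is nonincreasing. *)
pose h (t : R) : R := expR (- K * t) * S t.
have h_derive (t : R) : is_derive t 1 h (expR (- K * t) * (dS t - K * S t)).
  have dl : is_derive t 1 (fun t : R => - K * t) (- K).
    have := @is_deriveZ _ _ _ id (- K) t 1 1 (is_derive_id t 1) => /is_derive_eq; apply.
    by rewrite /GRing.scale /= mulr1.
  have de := @is_derive1_comp _ expR (fun t : R => - K * t) t _ _ (is_derive_expR _) dl.
  have := is_deriveM de (S_derive t) => /is_derive_eq; apply.
  rewrite mulrBr /GRing.scale /= !mulrN; congr (_ - _).
  by rewrite mulrC mulrA.

have h1 : h 1 <= h 0.
  apply: (@ler0_derive1_nincr _ h 0 1) => //.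
  - move=> t _; rewrite derive1E; have [_ ->] := h_derive t.
    by rewrite pmulr_rle0 ?expR_gt0 // subr_le0; exact: dS_le.
  - by apply: derivable_within_continuous => t _; exact: ex_derive.
have S0 : S 0 = 0 by rewrite /S big1 // => i _; rewrite u0 expr0n.
have S1 : S 1 <= 0 by move: h1; rewrite /h S0 mulr0 pmulr_rle0 ?expR_gt0.
move=> i; apply/eqP; rewrite -sqrf_eq0 eq_le sqr_ge0 andbT.
exact: le_trans (u_le i 1) S1.
Qed.

Lemma linear_ode_zero W (B : {linear W -> W}) (u : R -> W) : finite_coordinates W ->
  (forall t : R, is_derive t 1 u (B (u t))) -> u 0 = 0 -> u 1 = 0.
Proof.
move=> [I [e [c [cc ce]]]] du u0; rewrite [LHS]ce big1 // => i _.
suff -> : c i (u 1) = 0 by rewrite scale0r.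
apply: (@linear_ode_scalar I (fun i => c i \o u) (fun i j => c i (B (e j)))) => {}i.
  move=> t; have [dut uE] := du t.
  have du' : differentiable u t by apply/derivable1_diffP.
  apply: DeriveDef; first apply: diff_derivable.
    by apply: differentiable_comp => //; exact: linear_differentiable.
  rewrite derive_lin_comp // uE [in LHS](ce (u t)) !linear_sum; apply: eq_bigr => j _.
  by rewrite !linearZ /= mulrC.
by rewrite /= u0 linear0.
Qed.

End CkCalculus.

(** * Smooth maps into complex manifolds and Lie groups *)

Section Charts.
Variables (R : realType) (n : nat).

Lemma chart_img (T : Type) (c : chart R T n) x :
  chart_dom c x -> (chart_fun c @` chart_dom c) (chart_fun c x).
Proof. by move=> cx; exists x. Qed.

Variables (T : topologicalType) (c : chart R T n).
Hypothesis cP : is_chart c.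

Lemma chart_invK x : chart_dom c x -> chart_inv c (chart_fun c x) = x.
Proof. by case: cP => _ _ + _ _; apply. Qed.

Lemma chart_inv_dom u : (chart_fun c @` chart_dom c) u -> chart_dom c (chart_inv c u).
Proof. by move=> [x cx <-]; rewrite chart_invK. Qed.

Lemma chart_funK u : (chart_fun c @` chart_dom c) u -> chart_fun c (chart_inv c u) = u.
Proof. by move=> [x cx <-]; rewrite chart_invK. Qed.

Lemma chart_dom_near x : chart_dom c x -> nbhs x (chart_dom c).
Proof. by move=> cx; apply: open_nbhs_nbhs; split=> //; case: cP. Qed.

Lemma chart_img_near u : (chart_fun c @` chart_dom c) u -> nbhs u (chart_fun c @` chart_dom c).
Proof. by move=> cu; apply: open_nbhs_nbhs; split=> //; case: cP. Qed.

Lemma chart_fun_cont x : chart_dom c x -> {for x, continuous (chart_fun c)}.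
Proof. by case: cP => _ _ _ + _; apply. Qed.

Lemma chart_inv_cont x : chart_dom c x -> {for chart_fun c x, continuous (chart_inv c)}.
Proof. by case: cP => _ _ _ _ ci cx; apply/ci/chart_img. Qed.

Lemma open_chart_image (A : set T) :
  A `<=` chart_dom c -> open A -> open (chart_fun c @` A).
Proof.
move=> Ac Ao; rewrite openE => _ [x Ax <-]; rewrite /interior.
have nA : nbhs (chart_fun c x) (chart_inv c @^-1` A).
  apply: (chart_inv_cont (Ac _ Ax)); rewrite (chart_invK (Ac _ Ax)).
  exact: open_nbhs_nbhs.
apply: filterS2 nA (chart_img_near (chart_img (Ac _ Ax))) => u Au /chart_funK cu.
by exists (chart_inv c u).
Qed.

End Charts.

Section SmoothAt.
Variables (R : realType) (n : nat) (N : complex_manifold R n).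
Implicit Types (V : normedModType R) (q : N).
Local Notation c := chart_at.

Definition smooth_chart V q (f : V -> N) (U : set V) :=
  [/\ open U, forall u, U u -> chart_dom (c q) (f u) & smooth_on U (chart_fun (c q) \o f)].

(** With a normed space as source, one notion serves curves, local representatives and functions of
    two chart variables. A single chart is enough: [smooth_at_chart] passes to any other preferred
    chart around the value. *)
Definition smooth_at V (f : V -> N) u := exists q, exists2 U, U u & smooth_chart q f U.

Lemma open_near (X : topologicalType) (U : set X) : (forall x, U x -> nbhs x U) -> open U.
Proof. by move=> nU; rewrite openE => x /nU. Qed.

Lemma near_open (X : topologicalType) (U : set X) x : open U -> U x -> nbhs x U.
Proof. by move=> Uo Ux; exact: open_nbhs_nbhs. Qed.

Lemma Ck_near_differentiable V (W : normedModType R) (U : set V) (f : V -> W) u :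
  smooth_on U f -> U u -> differentiable f u.
Proof. by move=> /(_ 1%N) /CkS [+ _]; apply. Qed.

Lemma smooth_chart_continuous V q (f : V -> N) U u :
  smooth_chart q f U -> U u -> {for u, continuous f}.
Proof.
move=> [Uo fU sf] Uu; have cq := chart_atP q.
have ffE : \forall w \near u, chart_inv (c q) (chart_fun (c q) (f w)) = f w.
  by near=> w; apply: chart_invK => //; apply: fU; near: w; exact: near_open.
have : {for u, continuous (chart_inv (c q) \o (chart_fun (c q) \o f))}.
  apply: continuous_comp; first exact/differentiable_continuous/(Ck_near_differentiable sf).
  by apply: chart_inv_cont => //; exact: fU.
rewrite /prop_for /continuous_at /= (nbhs_singleton ffE) => cf.
apply: cvg_trans cf; apply: near_eq_cvg; exact: ffE.
Unshelve. all: by end_near. Qed.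

Lemma smooth_at_continuous V (f : V -> N) u : smooth_at f u -> {for u, continuous f}.
Proof. by move=> [q [U Uu sf]]; exact: smooth_chart_continuous sf Uu. Qed.

Lemma smooth_at_chart V (f : V -> N) u q : smooth_at f u -> chart_dom (c q) (f u) ->
  exists2 U, U u & smooth_chart q f U.
Proof.
move=> [q0 [U Uu sf]] qu; have [Uo fU sfU] := sf.
pose U' := U `&` f @^-1` chart_dom (c q).
have U'o : open U'.
  apply: open_near => w [Uw fw]; apply: filterI; first exact: near_open.
  apply: (smooth_chart_continuous sf Uw); exact: (chart_dom_near (chart_atP q)).
exists U'; first by split.
split=> // [w []|k] //; have [tk _] := transition_chart_at q0 q.
apply: (@Ck_ext _ _ _ k U' ((chart_fun (c q) \o chart_inv (c q0)) \o (chart_fun (c q0) \o f))) => //.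
  by move=> w; rewrite inE => -[Uw _] /=; rewrite chart_invK //; [exact: chart_atP|exact: fU].
apply: (Ck_comp (U' := chart_fun (c q0) @` (chart_dom (c q0) `&` chart_dom (c q)))) => //.
- exact: finite_coordinates_Cn.
- by move=> w [Uw fw]; exists (f w) => //; split=> //; exact: fU.
- by apply: Ck_sub (sfU k) => w [].
Qed.

Lemma smooth_at_differentiable V (f : V -> N) u q : smooth_at f u ->
  chart_dom (c q) (f u) -> differentiable (chart_fun (c q) \o f) u.
Proof.
by move=> /smooth_at_chart /[apply] -[U Uu [_ _ sf]]; exact: Ck_near_differentiable sf Uu.
Qed.

Lemma smooth_at_comp V (W : normedModType R) (h : W -> V) (U : set W) (f : V -> N) w :
  finite_coordinates V -> open U -> smooth_on U h -> U w -> smooth_at f (h w) ->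
  smooth_at (f \o h) w.
Proof.
move=> fV Uo sh Uw [q [U' U'w [U'o fU' sf]]]; exists q.
have hc x : U x -> {for x, continuous h} by move=> Ux; exact: (sh 0%N).
exists (U `&` h @^-1` U'); first by split.
have oo : open (U `&` h @^-1` U').
  apply: open_near => x [Ux U'x]; apply: filterI; first exact: near_open.
  by apply: (hc x Ux); exact: near_open.
split=> // [x [_ /fU']|k] //.
rewrite [_ \o _](_ : _ = (chart_fun (c q) \o f) \o h) //.
apply: (Ck_comp (U' := U')) => //; first by move=> x [].
by apply: Ck_sub (sh k) => x [].
Qed.

Lemma near_smooth_at V (f g : V -> N) u :
  (\near u, f u = g u) -> smooth_at f u -> smooth_at g u.
Proof.
move=> fg [q [U Uu [Uo fU sf]]]; pose U0 := interior [set w | f w = g w].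
have U0o : open U0 by exact: open_interior.
have U0u : U0 u by [].
have {}fg w : U0 w -> f w = g w by move=> /interior_subset.
exists q, (U `&` U0) => //; split=> [|x [Ux U0x]|k].
- exact: openI.
- by rewrite -(fg x U0x); exact: fU.
apply: (@Ck_ext _ _ _ k _ (chart_fun (c q) \o f)) => [||].
- exact: openI.
- by move=> x; rewrite inE => -[_ /fg /= ->].
- by apply: Ck_sub (sf k) => x [].
Qed.

Lemma smooth_at_cst V q u : smooth_at (fun _ : V => q) u.
Proof.
exists q, setT => //; split=> [|w _|k]; [exact: openT|exact: mem_chart_at|exact: Ck_cst].
Qed.

Lemma smooth_at_inv q u : (chart_fun (c q) @` chart_dom (c q)) u -> smooth_at (chart_inv (c q)) u.
Proof.
have cq := chart_atP q; move=> qu; exists q, (chart_fun (c q) @` chart_dom (c q)) => //.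
split=> [|w|k]; [by case: cq|exact: chart_inv_dom|].
apply: (@Ck_ext _ _ _ k _ id); first by case: cq.
  by move=> w; rewrite inE /= => /(chart_funK cq) ->.
have idc : continuous (idfun : {linear Cn R n -> Cn R n}) by move=> x; exact: cvg_id.
exact: (Ck_linear k _ idc).
Qed.

(** The T^(1,0) part of the velocity, in the preferred chart at the value [f u], so that it composes
    with [tangent_map]. *)
Definition tangent_vector V (f : V -> N) u v : 'rV[R[i]]_n :=
  cplx ('D_v (chart_fun (c (f u)) \o f) u).

Lemma tangent_vectorE V (f : V -> N) u v :
  tangent_vector f u v = cplx ('D_v (chart_fun (c (f u)) \o f) u).
Proof. by []. Qed.

Lemma near_tangent_vector V (f g : V -> N) u v :
  (\near u, f u = g u) -> tangent_vector f u v = tangent_vector g u v.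
Proof.
move=> fg; have fu : f u = g u by exact: nbhs_singleton fg.
rewrite /tangent_vector.
rewrite fu.
apply: (congr1 (@cplx R n)).
by apply: near_eq_derive; apply: filterS fg => w /= ->.
Qed.

Lemma eq_tangent_vector V (f g : V -> N) u v :
  f =1 g -> tangent_vector f u v = tangent_vector g u v.
Proof. by move=> /funext ->. Qed.

Lemma tangent_vector_cst V q u v : tangent_vector (fun _ : V => q) u v = 0.
Proof.
rewrite /tangent_vector (_ : _ \o _ = cst (chart_fun (c q) q)) // derive_cst.
by apply/rowP => j; rewrite !mxE.
Qed.

End SmoothAt.

Lemma cplxK (R : realType) n : cancel (@cplx R n) (@realv R n).
Proof.
by move=> [a b]; rewrite /realv /cplx /=; congr (_, _); apply/rowP => j; rewrite !mxE.
Qed.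

Lemma realvK (R : realType) n : cancel (@realv R n) (@cplx R n).
Proof. by move=> v; apply/rowP => j; rewrite !mxE /=; case: (v 0 j). Qed.

Section TangentMap.
Variables (R : realType) (m n : nat) (M : complex_manifold R m) (N : complex_manifold R n).
Local Notation c := chart_at.

Definition smooth_map_at (f : M -> N) p :=
  smooth_at (f \o chart_inv (c p)) (chart_fun (c p) p).

Lemma smooth_at_chain (V : normedModType R) (h : V -> M) (f : M -> N) u :
  smooth_at h u -> smooth_map_at f (h u) -> smooth_at (f \o h) u.
Proof.
move=> sh sf; have [U Uu [Uo hU shU]] := smooth_at_chart sh (mem_chart_at _).
apply: (@near_smooth_at _ _ _ _ ((f \o chart_inv (c (h u))) \o (chart_fun (c (h u)) \o h))).
  apply: filterS (near_open Uo Uu) => w Uw /=.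
  by rewrite chart_invK //; [exact: chart_atP|exact: hU].
exact: (smooth_at_comp (finite_coordinates_Cn _ _) Uo shU Uu).
Qed.

Lemma tangent_vector_chain (V : normedModType R) (h : V -> M) (f : M -> N) u v :
  smooth_at h u -> smooth_map_at f (h u) ->
  tangent_vector (f \o h) u v = tangent_map f (h u) (tangent_vector h u v).
Proof.
move=> sh sf; have hu := mem_chart_at (h u).
have [U Uu [Uo hU shU]] := smooth_at_chart sh hu.
rewrite /tangent_vector /tangent_map.
rewrite cplxK.
apply: (congr1 (@cplx R n)).
have K := chart_invK (chart_atP (h u)).
rewrite -(@derive_comp _ _ _ _ (chart_fun (c (h u)) \o h) (loc_rep (c (h u)) (c (f (h u))) f)).
- apply: near_eq_derive; apply: filterS (near_open Uo Uu) => w Uw /=.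
  by rewrite /loc_rep /= K //; exact: hU.
- exact: smooth_at_differentiable.
- have := smooth_at_differentiable (q := f (h u)) sf; apply.
  by rewrite /= K //; exact: mem_chart_at.
Qed.

Lemma tangent_mapE (f : M -> N) p x :
  tangent_map f p x = tangent_vector (f \o chart_inv (c p)) (chart_fun (c p) p) (realv x).
Proof.
rewrite /tangent_map /tangent_vector /= (chart_invK (chart_atP p)) //; exact: mem_chart_at.
Qed.

End TangentMap.

(** * Smoothness of the group operations and the logarithmic derivative *)

Section Group.
Variables (R : realType) (n : nat) (G : complex_lie_group R n).
Implicit Types (V : normedModType R) (g h : G).
Local Notation c := (@chart_at R n G).
Local Notation e := (lone G).
Local Infix "**" := (@lmul R n G) (at level 40, left associativity).

Lemma lmulgV g : g ** linv g = e.
Proof.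
rewrite -[LHS]lmul1g -(lmulVg (linv g)) -lmulA [linv g ** _]lmulA lmulVg lmul1g lmulVg.
by [].
Qed.

Lemma lmulg1 g : g ** e = g.
Proof. by rewrite -(lmulVg g) lmulA lmulgV lmul1g. Qed.

Lemma lmulKg g h : linv g ** (g ** h) = h.
Proof. by rewrite lmulA lmulVg lmul1g. Qed.

Lemma lmulVKg g h : g ** (linv g ** h) = h.
Proof. by rewrite lmulA lmulgV lmul1g. Qed.

Lemma linv_uniq g h : h ** g = e -> h = linv g.
Proof. by move=> hg; rewrite -[LHS]lmulg1 -(lmulgV g) lmulA hg lmul1g. Qed.

Lemma linvK g : linv (linv g) = g.
Proof. by rewrite -(linv_uniq (lmulgV g)). Qed.

Lemma linv1 : linv e = e.
Proof. by rewrite -(linv_uniq (lmul1g e)). Qed.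

Lemma linvM g h : linv (g ** h) = linv h ** linv g.
Proof. by rewrite -(linv_uniq (h := linv h ** linv g)) // -lmulA lmulKg lmulVg. Qed.

Lemma smooth_at_mul V (f h : V -> G) u :
  smooth_at f u -> smooth_at h u -> smooth_at (fun w => f w ** h w) u.
Proof.
move=> sf sh; pose p := f u; pose q := h u; pose r := p ** q.
have [U Uu [Uo fU sfU]] := smooth_at_chart sf (mem_chart_at p).
have [U' U'u [U'o hU' shU']] := smooth_at_chart sh (mem_chart_at q).
pose A := U `&` U' `&` [set w | chart_dom (c r) (f w ** h w)].
have Kp x := chart_invK (x := x) (chart_atP p).
have Kq x := chart_invK (x := x) (chart_atP q).
(* Holomorphy of the product is only given where the product lies in the chart at [r]; continuity of
   multiplication makes this an open condition. *)
have Ao : open A.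
  apply: open_near => w [[Uw U'w] rw]; apply: filterI.
    by apply: filterI; exact: near_open.
  have cfh : {for w, continuous (fun w => (f w, h w))}.
    by apply: cvg_pair; [exact: (smooth_chart_continuous (q := p) (U := U))
                        |exact: (smooth_chart_continuous (q := q) (U := U'))].
  apply: (continuous_comp cfh (lmul_continuous (c := G) (x := (f w, h w)))).
  exact: (chart_dom_near (chart_atP r)).
exists r, A; first by split=> //; exact: mem_chart_at.
split=> // [w []|k] //.
have [hol _] := lmul_holomorphic p q r.
apply: (@Ck_ext _ _ _ k A ((fun a : Cn R n * Cn R n => chart_fun (c r)
   (chart_inv (c p) a.1 ** chart_inv (c q) a.2)) \o
   (fun w => (chart_fun (c p) (f w), chart_fun (c q) (h w))))) => //.
  by move=> w; rewrite inE => -[[Uw U'w] _] /=; rewrite Kp ?Kq //; [exact: hU'|exact: fU].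
apply: (Ck_comp _ Ao _ _ (hol k)).
- by apply: finite_coordinates_pair; exact: finite_coordinates_Cn.
- move=> w [[Uw U'w] rw]; split=> /=.
  + by exists (f w) => //; exact: fU.
  + by exists (h w) => //; exact: hU'.
  + by rewrite Kp ?Kq //; [exact: hU'|exact: fU].
- apply: Ck_pair => //.
  + by apply: Ck_sub (sfU k) => w [[]].
  + by apply: Ck_sub (shU' k) => w [[]].
Qed.

Lemma linv_smooth g : smooth_map_at (@linv R n G) g.
Proof.
have [ci hol] := linv_holomorphic G.
have [sm _] := hol g (linv g).
exists (linv g), (loc_dom setT (c g) (c (linv g)) (@linv R n G)).
  exists g => //; split; last exact: mem_chart_at.
  by split=> //; exact: mem_chart_at.
split.
- apply: open_chart_image; [exact: chart_atP|by move=> w [[]]|].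
  apply: open_near => w [[_ gw] lw]; apply: filterI; first apply: filterI.
  + exact: filterT.
  + exact: (chart_dom_near (chart_atP g)).
  + apply: (ci w I); exact: (chart_dom_near (chart_atP (linv g))).
- by move=> _ [w [[_ gw] lw] <-] /=; rewrite (chart_invK (chart_atP g)).
- exact: sm.
Qed.

Lemma smooth_at_inverse V (f : V -> G) u :
  smooth_at f u -> smooth_at (fun w => linv (f w)) u.
Proof. by move=> sf; apply: (smooth_at_chain sf); exact: linv_smooth. Qed.

Lemma smooth_at_chart_inv g : smooth_at (chart_inv (c g)) (chart_fun (c g) g).
Proof. by apply: smooth_at_inv; exists g => //; exact: mem_chart_at. Qed.

Lemma lmul_smooth g h : smooth_map_at (lmul g) h.
Proof.
apply: (@smooth_at_mul _ (fun=> g)); first exact: smooth_at_cst.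
exact: smooth_at_chart_inv.
Qed.

Lemma rmul_smooth g h : smooth_map_at (fun a => a ** g) h.
Proof.
apply: (@smooth_at_mul _ (chart_inv (c h)) (fun=> g)); last exact: smooth_at_cst.
exact: smooth_at_chart_inv.
Qed.

Lemma conj_smooth g h : smooth_map_at (fun a => g ** a ** linv g) h.
Proof.
apply: (@smooth_at_mul _ (fun w => g ** chart_inv (c h) w) (fun=> linv g)).
  exact: lmul_smooth.
exact: smooth_at_cst.
Qed.

(** The pull-back of the Maurer-Cartan form, with the translation to the identity done before
    differentiating: all computations then take place in the one chart at [lone G]. *)
Definition log_derivative V (f : V -> G) u v := tangent_vector (fun w => linv (f u) ** f w) u v.

Lemma maurer_cartan_log_derivative V (f : V -> G) u v : smooth_at f u ->
  maurer_cartan (f u) (tangent_vector f u v) = log_derivative f u v.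
Proof.
move=> sf; rewrite /maurer_cartan -tangent_vector_chain //; exact: lmul_smooth.
Qed.

Lemma near_log_derivative V (f g : V -> G) u v :
  (\near u, f u = g u) -> log_derivative f u v = log_derivative g u v.
Proof.
move=> fg; rewrite /log_derivative (nbhs_singleton fg).
by apply: near_tangent_vector; apply: filterS fg => w ->.
Qed.

Lemma Ad_tangent_vector V (a : V -> G) g u v : smooth_at a u -> a u = e ->
  Ad g (tangent_vector a u v) = tangent_vector (fun w => g ** a w ** linv g) u v.
Proof.
by move=> sa au; rewrite /Ad -{1}au -tangent_vector_chain //; exact: conj_smooth.
Qed.

End Group.

(** * Complex scalars acting through the real structure *)

Section Complexification.
Variables (R : realType) (n : nat).
Implicit Types (u v : Cn R n) (x y : 'rV[R[i]]_n).

Lemma cplxD u v : cplx (u + v) = cplx u + cplx v.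
Proof. by apply/rowP => j; rewrite !mxE. Qed.

Lemma cplx0 : cplx (0 : Cn R n) = 0.
Proof. by apply/rowP => j; rewrite !mxE. Qed.

Lemma cplxN u : cplx (- u) = - cplx u.
Proof. by apply/rowP => j; rewrite !mxE. Qed.

Lemma cplxZ (a : R) u : cplx (a *: u) = a%:C%C *: cplx u.
Proof.
apply/rowP => j; rewrite !mxE; apply/eqP; rewrite eq_complex /=.
by rewrite !mul0r subr0 addr0 !eqxx.
Qed.

Lemma cplx_mul_i u : cplx (mul_i u) = 'i%C *: cplx u.
Proof.
apply/rowP => j; rewrite !mxE; apply/eqP; rewrite eq_complex /=.
by rewrite !mul0r !mul1r sub0r add0r !eqxx.
Qed.

Lemma realvD x y : realv (x + y) = realv x + realv y.
Proof. by apply: (can_inj (@cplxK R n)); rewrite cplxD !realvK. Qed.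

Lemma complexZE (a : R[i]) x :
  a *: x = (complex.Re a)%:C%C *: x + (complex.Im a)%:C%C *: ('i%C *: x).
Proof.
rewrite scalerA -scalerDl; congr (_ *: _); apply/eqP; case: a => a b; rewrite eq_complex /=.
by rewrite !mulr0 !mul0r !mulr1 subr0 !addr0 !add0r !eqxx.
Qed.

Lemma realvZ (a : R[i]) x :
  realv (a *: x) = complex.Re a *: realv x + complex.Im a *: mul_i (realv x).
Proof.
apply: (can_inj (@cplxK R n)).
by rewrite realvK cplxD !cplxZ cplx_mul_i realvK -complexZE.
Qed.

Lemma mul_i_linear : linear (@mul_i R n).
Proof.
by move=> a u v; rewrite /mul_i /= opprD -scalerN.
Qed.

Lemma derive_mul_i (V : normedModType R) (f : V -> Cn R n) (p v : V) :
  differentiable f p -> 'D_v (@mul_i R n \o f) p = mul_i ('D_v f p).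
Proof.
pose J : {linear Cn R n -> Cn R n} :=
  HB.pack (@mul_i R n) (GRing.isLinear.Build _ _ _ _ _ mul_i_linear).
have cJ : continuous J by apply: continuous_linear_fin; exact: finite_coordinates_Cn.
exact: (derive_lin_comp v cJ).
Qed.

End Complexification.

Lemma realv_cplx_linear (R : realType) n m (L : {linear 'rV[R[i]]_n -> 'rV[R[i]]_m}) :
  linear (@realv R m \o L \o @cplx R n).
Proof.
move=> a u w /=; apply: (can_inj (@cplxK R m)).
rewrite !cplxD !cplxZ !realvK.
by rewrite linearP.
Qed.

Lemma derive_complex_linear (R : realType) (V : normedModType R) n m
    (L : {linear 'rV[R[i]]_n -> 'rV[R[i]]_m}) (f : V -> Cn R n) (p v : V) :
  differentiable f p ->
  differentiable (@realv R m \o L \o @cplx R n \o f) p /\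
  'D_v (@realv R m \o L \o @cplx R n \o f) p = realv (L (cplx ('D_v f p))).
Proof.
pose L' : {linear Cn R n -> Cn R m} :=
  HB.pack (@realv R m \o L \o @cplx R n) (GRing.isLinear.Build _ _ _ _ _ (realv_cplx_linear L)).
have cL : continuous L' by apply: continuous_linear_fin; exact: finite_coordinates_Cn.
move=> df; split; last exact: (derive_lin_comp v cL df).
have dL : differentiable (L' : _ -> _) (f p) by exact: linear_differentiable.
exact: (differentiable_comp df dL).
Qed.

Section TangentLinear.
Variables (R : realType) (m n : nat) (M : complex_manifold R m) (N : complex_manifold R n).
Local Notation c := chart_at.

Lemma tangent_vector_add (V : normedModType R) (f : V -> N) u v w : smooth_at f u ->
  tangent_vector f u (v + w) = tangent_vector f u v + tangent_vector f u w.
Proof.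
move=> sf; rewrite /tangent_vector derive_add_dir ?cplxD //.
exact: (smooth_at_differentiable sf (mem_chart_at _)).
Qed.

Lemma tangent_vector_scale (V : normedModType R) (f : V -> N) u (a : R) v :
  smooth_at f u -> tangent_vector f u (a *: v) = a%:C%C *: tangent_vector f u v.
Proof.
move=> sf; rewrite /tangent_vector derive_scale_dir ?cplxZ //.
exact: (smooth_at_differentiable sf (mem_chart_at _)).
Qed.

(** Real linearity is automatic; the Cauchy-Riemann equations at the point add commutation with
    multiplication by i, and a complex scalar is a real combination of 1 and i. *)
Lemma tangent_map_linear (f : M -> N) p : smooth_map_at f p ->
  (forall v, 'D_(mul_i v) (loc_rep (c p) (c (f p)) f) (chart_fun (c p) p) =
             mul_i ('D_v (loc_rep (c p) (c (f p)) f) (chart_fun (c p) p))) ->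
  linear (tangent_map f p).
Proof.
move=> sf hol a x y; rewrite !tangent_mapE realvD tangent_vector_add // realvZ.
rewrite tangent_vector_add // !tangent_vector_scale // [in RHS]complexZE.
congr (_ + _ *: _ + _); rewrite -!tangent_mapE /tangent_map.
have pK := chart_invK (chart_atP p) (mem_chart_at p).
rewrite /tangent_vector /= pK -cplx_mul_i -hol.
by [].
Qed.

End TangentLinear.

Section GroupDifferentials.
Variables (R : realType) (n : nat) (G : complex_lie_group R n).
Implicit Types (V : normedModType R) (g h : G).
Local Notation c := (@chart_at R n G).
Local Notation e := (lone G).
Local Notation o := (chart_fun (c e) e).
Local Notation inv_e := (chart_inv (c e)).
Local Infix "**" := (@lmul R n G) (at level 40, left associativity).

Lemma inv_e_o : inv_e o = e.
Proof. exact: (chart_invK (chart_atP e) (mem_chart_at e)). Qed.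

Lemma smooth_on_linear V (W : normedModType R) (L : {linear V -> W}) :
  continuous L -> smooth_on setT L.
Proof. by move=> cL k; exact: Ck_linear. Qed.

Lemma smooth_inv_e_fst a : smooth_at (fun a : Cn R n * Cn R n => inv_e a.1) (o, a).
Proof.
apply: (@smooth_at_comp _ _ _ _ _ (fst : Cn R n * Cn R n -> Cn R n) setT) => //.
- exact: finite_coordinates_Cn.
- exact: openT.
- apply: smooth_on_linear => x; exact: cvg_fst.
- exact: smooth_at_chart_inv.
Qed.

Lemma smooth_inv_e_snd a : smooth_at (fun a : Cn R n * Cn R n => inv_e a.2) (a, o).
Proof.
apply: (@smooth_at_comp _ _ _ _ _ (snd : Cn R n * Cn R n -> Cn R n) setT) => //.
- exact: finite_coordinates_Cn.
- exact: openT.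
- apply: smooth_on_linear => x; exact: cvg_snd.
- exact: smooth_at_chart_inv.
Qed.

Lemma chart_inv_e_near : \forall u \near o, chart_fun (c e) (inv_e u) = u.
Proof.
have cP := chart_atP e; have eo := chart_img (mem_chart_at e).
by apply: filterS (chart_img_near cP eo) => u; exact: chart_funK.
Qed.

Definition mul_e (a : Cn R n * Cn R n) : Cn R n := chart_fun (c e) (inv_e a.1 ** inv_e a.2).

Lemma mul_e_differentiable : differentiable mul_e (o, o).
Proof.
have sm := smooth_at_mul (smooth_inv_e_fst o) (smooth_inv_e_snd o).
by have := smooth_at_differentiable (q := e) sm; apply; rewrite /= inv_e_o lmul1g; exact: mem_chart_at.
Qed.

(** It is enough to vary one factor at a time; with the other factor frozen at the identity, [mul_e]
    is the identity map near [o]. *)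
Lemma derive_mul_e a b : 'D_((a, b) : Cn R n * Cn R n) mul_e (o, o) = a + b.
Proof.
have id_diff : differentiable (id : Cn R n -> Cn R n) o by [].
have cst_diff : differentiable (fun _ : Cn R n => o) o by exact: differentiable_cst.
have -> : ((a, b) : Cn R n * Cn R n) = (a, 0) + (0, b).
  by congr (_, _); rewrite /= ?addr0 ?add0r.
rewrite derive_add_dir; last exact: mul_e_differentiable.
congr (_ + _).
- have <- : 'D_a (fun w : Cn R n => (w, o)) o = (a, 0).
    by rewrite derive_pair // derive_id derive_cst.
  have dp : differentiable (fun w : Cn R n => (w, o)) o by exact: differentiable_pair.
  rewrite -(derive_comp a dp mul_e_differentiable).
  rewrite -[RHS](derive_id o a); apply: near_eq_derive.
  by apply: filterS chart_inv_e_near => w /= wE; rewrite /mul_e /= inv_e_o lmulg1.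
- have <- : 'D_b (fun w : Cn R n => (o, w)) o = (0, b).
    by rewrite derive_pair // derive_id derive_cst.
  have dp : differentiable (fun w : Cn R n => (o, w)) o by exact: differentiable_pair.
  rewrite -(derive_comp b dp mul_e_differentiable).
  rewrite -[RHS](derive_id o b); apply: near_eq_derive.
  by apply: filterS chart_inv_e_near => w /= wE; rewrite /mul_e /= inv_e_o lmul1g.
Qed.

Lemma tangent_vector_mul V (f h : V -> G) u v : smooth_at f u -> smooth_at h u ->
  f u = e -> h u = e ->
  tangent_vector (fun w => f w ** h w) u v = tangent_vector f u v + tangent_vector h u v.
Proof.
move=> sf sh fu hu; rewrite /tangent_vector fu hu lmul1g -cplxD.
have ee := mem_chart_at e.
have df : differentiable (chart_fun (c e) \o f) u by apply: smooth_at_differentiable; rewrite ?fu.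
have dh : differentiable (chart_fun (c e) \o h) u by apply: smooth_at_differentiable; rewrite ?hu.
have [U Uu [Uo fU _]] : exists2 U, U u & smooth_chart e f U by apply: smooth_at_chart; rewrite ?fu.
have [U' U'u [U'o hU' _]] : exists2 U, U u & smooth_chart e h U by apply: smooth_at_chart; rewrite ?hu.
rewrite -derive_mul_e; apply: (congr1 (@cplx R n)).
have -> : ('D_v (chart_fun (c e) \o f) u, 'D_v (chart_fun (c e) \o h) u) =
  'D_v (fun w => ((chart_fun (c e) \o f) w, (chart_fun (c e) \o h) w)) u.
  by rewrite derive_pair.
have ooE : (o, o) = ((chart_fun (c e) \o f) u, (chart_fun (c e) \o h) u) by rewrite /= fu hu.
have dp := differentiable_pair df dh.
have dm : differentiable mul_e ((chart_fun (c e) \o f) u, (chart_fun (c e) \o h) u).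
  by rewrite -ooE; exact: mul_e_differentiable.
rewrite ooE -(derive_comp v dp dm).
apply: near_eq_derive; apply: filterS2 (near_open Uo Uu) (near_open U'o U'u) => w Uw U'w.
by rewrite /mul_e /= !(chart_invK (chart_atP e)) //; [exact: hU'|exact: fU].
Qed.

Lemma log_derivative_mul V (f h : V -> G) u v : smooth_at f u -> smooth_at h u ->
  log_derivative (fun w => f w ** h w) u v =
  Ad (linv (h u)) (log_derivative f u v) + log_derivative h u v.
Proof.
move=> sf sh; rewrite /log_derivative.
have sf' : smooth_at (fun w => linv (f u) ** f w) u by apply: smooth_at_mul => //; exact: smooth_at_cst.
have sh' : smooth_at (fun w => linv (h u) ** h w) u by apply: smooth_at_mul => //; exact: smooth_at_cst.
rewrite Ad_tangent_vector ?lmulVg // linvK.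
(* The translated product f h factors as this conjugate of the translated f times the translated h,
   and both factors equal the identity at [u]. *)
pose a w := linv (h u) ** (linv (f u) ** f w) ** h u.
have sa : smooth_at a u.
  by do 2![apply: smooth_at_mul; rewrite //; try exact: smooth_at_cst].
rewrite -(tangent_vector_mul v sa sh'); last by rewrite lmulVg.
  apply: eq_tangent_vector => w.
  by rewrite /a linvM -!lmulA lmulVKg.
by rewrite /a lmulVg lmulg1 lmulVg.
Qed.

End GroupDifferentials.

(** * The adjoint representation and its dependence on the group element *)

Section Adjoint.
Variables (R : realType) (n : nat) (G : complex_lie_group R n).
Implicit Types (V : normedModType R) (g h : G).
Local Notation c := (@chart_at R n G).
Local Notation e := (lone G).
Local Notation o := (chart_fun (c e) e).
Local Notation inv_e := (chart_inv (c e)).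
Local Infix "**" := (@lmul R n G) (at level 40, left associativity).

Lemma derive_lmul_holomorphic g h (v w : Cn R n) :
  let F a := chart_fun (c (g ** h)) (chart_inv (c g) a.1 ** chart_inv (c h) a.2) in
  let p := (chart_fun (c g) g, chart_fun (c h) h) in
  differentiable F p /\ 'D_(mul_i v, mul_i w) F p = mul_i ('D_(v, w) F p).
Proof.
move=> F p; have [sF hF] := lmul_holomorphic g h (g ** h).
have Dp : [/\ (chart_fun (c g) @` chart_dom (c g)) p.1, (chart_fun (c h) @` chart_dom (c h)) p.2 &
    chart_dom (c (g ** h)) (chart_inv (c g) p.1 ** chart_inv (c h) p.2)].
  split; [exact/chart_img/mem_chart_at|exact/chart_img/mem_chart_at|].
  by rewrite /= !(chart_invK (chart_atP _)) //; exact: mem_chart_at.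
by split; [exact: (Ck_near_differentiable sF Dp)|exact: (hF p (v, w) Dp)].
Qed.

Lemma tangent_map_lmul_linear g h : linear (tangent_map (lmul g) h).
Proof.
apply: tangent_map_linear; first exact: lmul_smooth.
have K k : chart_inv (c k) (chart_fun (c k) k) = k.
  exact: (chart_invK (chart_atP k) (mem_chart_at k)).
pose F a := chart_fun (c (g ** h)) (chart_inv (c g) a.1 ** chart_inv (c h) a.2).
pose j (w : Cn R n) : Cn R n * Cn R n := (chart_fun (c g) g, w).
have jd w : differentiable j w by apply: differentiable_pair => //; exact: differentiable_cst.
have Fd := (derive_lmul_holomorphic g h 0 0).1.
have E v : 'D_v (loc_rep (c h) (c (g ** h)) (lmul g)) (chart_fun (c h) h) =
    'D_(0, v) F (chart_fun (c g) g, chart_fun (c h) h).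
  have <- : 'D_v j (chart_fun (c h) h) = (0, v).
    by rewrite derive_pair // ?derive_cst ?derive_id //; exact: differentiable_cst.
  rewrite -(derive_comp v (jd _) Fd); apply: eq_derive => w.
  by rewrite /F /loc_rep /= K.
move=> v; rewrite !E; have [_ <-] := derive_lmul_holomorphic g h 0 v.
by rewrite /mul_i /= oppr0.
Qed.

Lemma tangent_map_rmul_linear g h : linear (tangent_map (fun a => a ** g) h).
Proof.
apply: tangent_map_linear; first exact: rmul_smooth.
have K k : chart_inv (c k) (chart_fun (c k) k) = k.
  exact: (chart_invK (chart_atP k) (mem_chart_at k)).
pose F a := chart_fun (c (h ** g)) (chart_inv (c h) a.1 ** chart_inv (c g) a.2).
pose j (w : Cn R n) : Cn R n * Cn R n := (w, chart_fun (c g) g).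
have jd w : differentiable j w by apply: differentiable_pair => //; exact: differentiable_cst.
have Fd := (derive_lmul_holomorphic h g 0 0).1.
have E v : 'D_v (loc_rep (c h) (c (h ** g)) (fun a => a ** g)) (chart_fun (c h) h) =
    'D_(v, 0) F (chart_fun (c h) h, chart_fun (c g) g).
  have <- : 'D_v j (chart_fun (c h) h) = (v, 0).
    by rewrite derive_pair // ?derive_cst ?derive_id //; exact: differentiable_cst.
  rewrite -(derive_comp v (jd _) Fd); apply: eq_derive => w.
  by rewrite /F /loc_rep /= K.
move=> v; rewrite !E; have [_ <-] := derive_lmul_holomorphic h g v 0.
by rewrite /mul_i /= oppr0.
Qed.

Lemma maurer_cartan_linear g : linear (maurer_cartan g).
Proof. exact: tangent_map_lmul_linear. Qed.

(** Conjugation is split into a left and a right translation because complex linearity is already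
    known for the differentials of these. *)
Lemma AdE g x : Ad g x = tangent_map (fun a => a ** linv g) ((lmul g \o inv_e) o)
  (tangent_vector (lmul g \o inv_e) o (realv x)).
Proof.
rewrite /Ad tangent_mapE.
have sl : smooth_at (lmul g \o inv_e) o by exact: lmul_smooth.
exact: (tangent_vector_chain (realv x) sl (rmul_smooth (linv g) _)).
Qed.

Lemma Ad_is_linear g : linear (Ad g).
Proof.
move=> a x y; rewrite !AdE.
have E z : tangent_vector (lmul g \o inv_e) o (realv z) = tangent_map (lmul g) e z.
  by rewrite [RHS]tangent_mapE.
by rewrite !E tangent_map_lmul_linear tangent_map_rmul_linear.
Qed.

HB.instance Definition _ g :=
  GRing.isLinear.Build R[i] 'rV[R[i]]_n 'rV[R[i]]_n *:%R (Ad g) (Ad_is_linear g).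

Lemma tangent_vector_inv_e v : tangent_vector inv_e o v = cplx v.
Proof.
rewrite /tangent_vector inv_e_o; apply: (congr1 (@cplx R n)).
rewrite -[RHS](derive_id o v); apply: near_eq_derive; exact: chart_inv_e_near.
Qed.

Lemma Ad_tangent g v :
  Ad g (cplx v) = tangent_vector (fun w => g ** inv_e w ** linv g) o v.
Proof.
rewrite -tangent_vector_inv_e Ad_tangent_vector ?inv_e_o //; exact: smooth_at_chart_inv.
Qed.

Lemma Ad1 x : Ad e x = x.
Proof.
rewrite -[in LHS](realvK x) Ad_tangent -[RHS]realvK -tangent_vector_inv_e.
by apply: eq_tangent_vector => w; rewrite linv1 lmul1g lmulg1.
Qed.

Lemma AdM g h x : Ad (g ** h) x = Ad g (Ad h x).
Proof.
rewrite -(realvK x) (Ad_tangent (g ** h)) (Ad_tangent h) Ad_tangent_vector.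
- by apply: eq_tangent_vector => w; rewrite linvM !lmulA.
- exact: conj_smooth.
- by rewrite inv_e_o lmulg1 lmulgV.
Qed.

Lemma AdK g x : Ad (linv g) (Ad g x) = x.
Proof. by rewrite -AdM lmulVg Ad1. Qed.

Lemma AdKV g x : Ad g (Ad (linv g) x) = x.
Proof. by rewrite -AdM lmulgV Ad1. Qed.

(** Conjugation in the chart at the identity. Its derivative in the second variable at [o] is [Ad],
    and its mixed second derivative at [(o, o)] is the bracket. *)
Definition conj_e (a : Cn R n * Cn R n) : Cn R n :=
  chart_fun (c e) (inv_e a.1 ** inv_e a.2 ** linv (inv_e a.1)).

Lemma conj_e_smooth : exists U, [/\ open U, U (o, o),
  forall a, U a -> chart_dom (c e) (inv_e a.1 ** inv_e a.2 ** linv (inv_e a.1)) &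
  smooth_on U conj_e].
Proof.
have s1 := smooth_inv_e_fst G o; have s2 := smooth_inv_e_snd G o.
have sK := smooth_at_mul (smooth_at_mul s1 s2) (smooth_at_inverse s1).
have [|U Uo [oU UK sU]] := smooth_at_chart (q := e) sK.
  by rewrite /= inv_e_o !lmul1g linv1; exact: mem_chart_at.
by exists U.
Qed.

Definition Ad_chart y (u : Cn R n) := realv (Ad (inv_e u) y).

(** A whole neighbourhood of [o] is needed, since the formula is differentiated once more; it is
    chosen independently of [y]. *)
Lemma Ad_chartE : exists2 U : set (Cn R n), nbhs o U &
  forall y u, U u -> Ad_chart y u = 'D_(0, realv y) conj_e (u, o).
Proof.
have [U [oU Uoo UK sU]] := conj_e_smooth.
exists [set u | U (u, o)].
  have cj : {for o, continuous (fun u : Cn R n => (u, o))}.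
    by apply/differentiable_continuous/differentiable_pair => //; exact: differentiable_cst.
  by apply: cj; exact: near_open.
move=> y u Uu /=; rewrite /Ad_chart -[in LHS](realvK y) Ad_tangent.
have cE : inv_e u ** inv_e o ** linv (inv_e u) = e by rewrite inv_e_o lmulg1 lmulgV.
rewrite /tangent_vector cE cplxK.
pose j (w : Cn R n) : Cn R n * Cn R n := (u, w).
have jd : differentiable j o by apply: differentiable_pair => //; exact: differentiable_cst.
have <- : 'D_(realv y) j o = (0, realv y).
  by rewrite derive_pair // ?derive_cst ?derive_id //; exact: differentiable_cst.
have Kd : differentiable conj_e (j o) by exact: (Ck_near_differentiable sU).
by rewrite -(derive_comp _ jd Kd).
Qed.

Lemma derive_Ad_chart y : differentiable (Ad_chart y) o /\
  forall v, 'D_v (Ad_chart y) o =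
            'D_(v, 0) ('D_(0, realv y) conj_e) (o, o).
Proof.
have [U [oU Uoo UK sU]] := conj_e_smooth; have [U' nU' AdU'] := Ad_chartE.
have E : \forall u \near o, 'D_(0, realv y) conj_e (u, o) = Ad_chart y u.
  by apply: filterS nU' => u /AdU' ->.
have /CkS [_ /(_ (0, realv y)) /CkS [dK _]] := sU 2%N; have dKo := dK _ Uoo.
have cst_diff : differentiable (fun _ : Cn R n => o) o by exact: differentiable_cst.
have jd : differentiable (fun u : Cn R n => (u, o)) o by exact: differentiable_pair.
split; first exact: near_differentiable E (differentiable_comp jd dKo).
move=> v; rewrite -(near_eq_derive v E).
have -> : (v, 0) = 'D_v (fun u : Cn R n => (u, o)) o.
  by rewrite derive_pair // derive_id derive_cst.
by rewrite -(derive_comp v jd dKo).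
Qed.

End Adjoint.

(** * The Lie bracket *)

Section Bracket.
Variables (R : realType) (n : nat) (G : complex_lie_group R n).
Implicit Types (V : normedModType R) (g h : G) (x y z : 'rV[R[i]]_n).
Local Notation c := (@chart_at R n G).
Local Notation e := (lone G).
Local Notation o := (chart_fun (c e) e).
Local Notation inv_e := (chart_inv (c e)).
Local Infix "**" := (@lmul R n G) (at level 40, left associativity).

Lemma lie_bracketE x y : lie_bracket G x y = cplx ('D_(realv x) (@Ad_chart R n G y) o).
Proof. by []. Qed.

(** Extends the definition of the bracket from the chart at the identity to any smooth family
    through the identity. *)
Lemma derive_Ad V (a : V -> G) u v y : smooth_at a u -> a u = e ->
  differentiable (fun w => realv (Ad (a w) y)) u /\
  'D_v (fun w => realv (Ad (a w) y)) u = realv (lie_bracket G (tangent_vector a u v) y).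
Proof.
move=> sa au.
have [U Uu [Uo aU _]] : exists2 U, U u & smooth_chart e a U.
  by apply: smooth_at_chart; rewrite ?au //; exact: mem_chart_at.
pose f := chart_fun (c e) \o a.
have da : differentiable f u.
  by apply: smooth_at_differentiable; rewrite ?au //; exact: mem_chart_at.
have [dAd _] := derive_Ad_chart G y.
have dAd' : differentiable (@Ad_chart R n G y) (f u) by rewrite /f /= au.
have E : \forall w \near u, (@Ad_chart R n G y \o f) w = realv (Ad (a w) y).
  apply: filterS (near_open Uo Uu) => w Uw; rewrite /= /Ad_chart /f /=.
  by rewrite (chart_invK (chart_atP e)) //; exact: aU.
split; first exact: near_differentiable E (differentiable_comp da dAd').
rewrite -(near_eq_derive v E) (derive_comp v da dAd') lie_bracketE.
rewrite (cplxK ('D_(realv (tangent_vector a u v)) (@Ad_chart R n G y) o)).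
have -> : realv (tangent_vector a u v) = 'D_v f u by rewrite /tangent_vector au; exact: cplxK.
by rewrite /f /= au.
Qed.

Lemma lie_bracket_linearr x : linear (lie_bracket G x).
Proof.
move=> a y z; rewrite !lie_bracketE.
have [dy _] := derive_Ad_chart G y; have [dz _] := derive_Ad_chart G z.
pose L : {linear 'rV[R[i]]_n -> 'rV[R[i]]_n} := ( *:%R a).
pose F := @realv R n \o L \o @cplx R n \o @Ad_chart R n G y.
have [dLy DLy] : differentiable F o /\ 'D_(realv x) F o = realv (L (cplx ('D_(realv x) (@Ad_chart R n G y) o))).
  exact: derive_complex_linear.
have E : @Ad_chart R n G (a *: y + z) =1 F + @Ad_chart R n G z.
  move=> u; rewrite /Ad_chart linearP realvD; apply: (congr1 (fun t => t + realv (Ad (inv_e u) z))).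
  exact: (congr1 (fun t => realv (a *: t)) (esym (realvK (Ad (inv_e u) y)))).
have d1 : derivable F o (realv x) by exact: diff_derivable.
have d2 : derivable (@Ad_chart R n G z) o (realv x) by exact: diff_derivable.
have T := etrans (eq_derive o (realv x) E) (deriveD d1 d2).
apply: (etrans (congr1 (@cplx R n) T)); apply: (etrans (cplxD _ _)).
apply: (congr1 (fun t => t + cplx ('D_(realv x) (@Ad_chart R n G z) o))).
apply: (etrans (congr1 (@cplx R n) DLy)); exact: realvK.
Qed.

Lemma mul_e_holomorphic (a : Cn R n * Cn R n) v w :
  (chart_fun (c e) @` chart_dom (c e)) a.1 -> (chart_fun (c e) @` chart_dom (c e)) a.2 ->
  chart_dom (c e) (inv_e a.1 ** inv_e a.2) ->
  differentiable (@mul_e R n G) a /\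
  'D_(mul_i v, mul_i w) (@mul_e R n G) a = mul_i ('D_(v, w) (@mul_e R n G) a).
Proof.
move=> a1 a2 ma; have [sm hol] := lmul_holomorphic (c := G) e e e.
have Da : [/\ (chart_fun (c e) @` chart_dom (c e)) a.1,
   (chart_fun (c e) @` chart_dom (c e)) a.2 & chart_dom (c e) (inv_e a.1 ** inv_e a.2)] by [].
by split; [exact: (Ck_near_differentiable sm Da)|exact: (hol a (v, w) Da)].
Qed.

Lemma linv_e_holomorphic u v :
  (chart_fun (c e) @` chart_dom (c e)) u -> chart_dom (c e) (linv (inv_e u)) ->
  let i_e w := chart_fun (c e) (linv (inv_e w)) in
  differentiable i_e u /\ 'D_(mul_i v) i_e u = mul_i ('D_v i_e u).
Proof.
move=> [g eg <-] lg i_e; have [_ hol] := linv_holomorphic G; have [sm {}hol] := hol e e.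
have Du : loc_dom setT (c e) (c e) (@linv R n G) (chart_fun (c e) g).
  by exists g => //; split=> //; rewrite /= -[g](chart_invK (chart_atP e)).
by split; [exact: (Ck_near_differentiable sm Du)|exact: (hol _ v Du)].
Qed.

(** Near [(o, o)] conjugation is the composite of [mul_e] with the pair formed by [mul_e] and
    inversion of the first variable, each satisfying the Cauchy-Riemann equations. The identity is
    proved on a neighbourhood because it is differentiated afterwards. *)
Lemma conj_e_holomorphic v : \forall a \near (o, o),
  'D_(mul_i v, 0) (@conj_e R n G) a = mul_i ('D_(v, 0) (@conj_e R n G) a).
Proof.
have s1 := smooth_inv_e_fst G o; have s2 := smooth_inv_e_snd G o.
have s12 := smooth_at_mul s1 s2; have s3 := smooth_at_inverse s1.
have sK := smooth_at_mul s12 s3.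
have near_dom (f : Cn R n * Cn R n -> G) : smooth_at f (o, o) -> f (o, o) = e ->
    \forall a \near (o, o), chart_dom (c e) (f a).
  move=> sf fo; have [|U Uo [oU UK _]] := smooth_at_chart (q := e) sf.
    by rewrite fo; exact: mem_chart_at.
  by apply: filterS (near_open oU Uo).
have N12 := near_dom _ s12; have N3 := near_dom _ s3; have NK := near_dom _ sK.
have img_near : \forall u \near o, (chart_fun (c e) @` chart_dom (c e)) u.
  exact: (chart_img_near (chart_atP e) (chart_img (mem_chart_at e))).
have I1 : \forall a \near (o, o), (chart_fun (c e) @` chart_dom (c e)) (a : Cn R n * Cn R n).1.
  exact: (cvg_fst img_near).
have I2 : \forall a \near (o, o), (chart_fun (c e) @` chart_dom (c e)) (a : Cn R n * Cn R n).2.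
  exact: (cvg_snd img_near).
pose P (a : Cn R n * Cn R n) := [/\ (chart_fun (c e) @` chart_dom (c e)) a.1,
  (chart_fun (c e) @` chart_dom (c e)) a.2, chart_dom (c e) (inv_e a.1 ** inv_e a.2),
  chart_dom (c e) (linv (inv_e a.1)) &
  chart_dom (c e) (inv_e a.1 ** inv_e a.2 ** linv (inv_e a.1))].
have nP : \forall a \near (o, o), P a.
  have {}N12 := N12 _; have {}N3 := N3 _; have {}NK := NK _.
  near=> a; split.
  - by near: a.
  - by near: a.
  - by near: a; apply: N12; rewrite /= inv_e_o lmul1g.
  - by near: a; apply: N3; rewrite /= inv_e_o linv1.
  - by near: a; apply: NK; rewrite /= inv_e_o !lmul1g linv1.
pose i_e (u : Cn R n) := chart_fun (c e) (linv (inv_e u)).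
pose F (a : Cn R n * Cn R n) := ((@mul_e R n G) a, i_e a.1).
have inv_mul a : P a -> inv_e ((@mul_e R n G) a) = inv_e a.1 ** inv_e a.2.
  by case=> *; rewrite /mul_e (chart_invK (chart_atP e)).
have inv_inv a : P a -> inv_e (i_e a.1) = linv (inv_e a.1).
  by case=> *; rewrite /i_e (chart_invK (chart_atP e)).
have KE a : P a -> ((@mul_e R n G) \o F) a = (@conj_e R n G) a.
  by move=> Pa; rewrite /= {1}/mul_e /conj_e /= inv_mul // inv_inv.
(* Passing to the interior makes the factorization [KE] hold around [a], so that derivatives at [a]
   may be compared. *)
have nI : \forall a \near (o, o), interior P a by exact: nbhs_interior.
apply: filterS nI => a nPa; have Pa := nbhs_singleton nPa; have [a1 a2 ma la ta] := Pa.
have Ea : \forall a' \near a, ((@mul_e R n G) \o F) a' = (@conj_e R n G) a' by apply: filterS nPa.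
have dfst : differentiable (fst : Cn R n * Cn R n -> Cn R n) a.
  by apply: linear_differentiable => x; exact: cvg_fst.
have [di _] := linv_e_holomorphic 0 a1 la.
have [dm _] := mul_e_holomorphic 0 0 a1 a2 ma.
have dif : differentiable (i_e \o fst) a by exact: (differentiable_comp dfst di).
have dF : differentiable F a by exact: differentiable_pair.
have DF w : 'D_(w, 0) F a = ('D_(w, 0) (@mul_e R n G) a, 'D_w i_e a.1).
  rewrite derive_pair // (derive_comp _ dfst di) derive_lin //.
have mF := @mul_e_holomorphic (F a) _ _ (chart_img ma) (chart_img la) _.
have {}mF v1 v2 := mF v1 v2 _.
have tF : chart_dom (c e) (inv_e (F a).1 ** inv_e (F a).2) by rewrite /= inv_mul // inv_inv.
have [dmF _] := mF tF 0 0.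
have DK w : 'D_(w, 0) (@conj_e R n G) a = 'D_('D_(w, 0) F a) (@mul_e R n G) (F a).
  by rewrite -(near_eq_derive _ Ea) (derive_comp _ dF dmF).
rewrite !DK !DF -(mF tF _ _).2; congr ('D__ _ _); congr (_, _).
  rewrite -(mul_e_holomorphic v 0 a1 a2 ma).2; congr ('D__ _ _).
  by rewrite /mul_i /= oppr0.
by rewrite -(linv_e_holomorphic v a1 la).2.
Unshelve. all: by end_near. Qed.

(* [lie_bracket G x y] is the mixed derivative of [conj_e] along [(x, 0)] and
   [(0, y)]; swapping the two derivatives, complex linearity in [x] becomes the
   Cauchy-Riemann equations of [conj_e]. *)
Lemma lie_bracket_linearl y : linear (fun x => lie_bracket G x y).
Proof.
have [dy Dy] := derive_Ad_chart  G y.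
have [U [oU Uoo UK sU]] := conj_e_smooth G.
have Ji v : lie_bracket G ('i%C *: cplx v) y = 'i%C *: lie_bracket G (cplx v) y.
  rewrite !lie_bracketE -cplx_mul_i !cplxK -cplx_mul_i; apply: (congr1 (@cplx R n)).
  have swap w := @derive_swap _ _ _ U _ _ (w, 0) (0, realv y) (finite_coordinates_Cn R n) oU (sU 2%N) Uoo.
  have /CkS [_ /(_ (v, 0)) /CkS [dv _]] := sU 2%N.
  apply: (etrans (Dy _)); apply: (etrans (swap _)).
  apply: (etrans _ (congr1 (@mul_i R n) (esym (etrans (Dy v) (swap v))))).
  apply: (etrans (near_eq_derive _ (conj_e_holomorphic v))).
  exact: derive_mul_i _ (dv _ Uoo).
move=> a x z; rewrite complexZE; set ix := 'i%C *: x.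
have E : lie_bracket G ix y = 'i%C *: lie_bracket G x y by rewrite /ix -[x]realvK Ji.
rewrite [in RHS]complexZE -E.
have Z (b : R) (w : 'rV[R[i]]_n) : realv (b%:C%C *: w) = b *: realv w.
  by apply: (can_inj (@cplxK R n)); rewrite cplxZ !realvK.
have [d [LE dD dZ]] : exists d : Cn R n -> 'rV[R[i]]_n,
    [/\ forall t, lie_bracket G t y = d (realv t), {morph d : u v / u + v} &
        forall (b : R) u, d (b *: u) = b%:C%C *: d u].
  exists (fun u => cplx ('D_u (@Ad_chart R n G y) o)); split.
  - by move=> t; exact: lie_bracketE.
  - by move=> u v; exact: (etrans (congr1 (@cplx R n) (derive_add_dir u v dy)) (cplxD _ _)).
  - by move=> b u; exact: (etrans (congr1 (@cplx R n) (derive_scale_dir b u dy)) (cplxZ _ _)).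
by rewrite !LE !realvD !Z !dD !dZ.
Qed.

(** Differentiate at a = e the identity Ad(g) Ad(a) y = Ad(g a g^-1) Ad(g) y. *)
Lemma Ad_lie_bracket g x y : Ad g (lie_bracket G x y) = lie_bracket G (Ad g x) (Ad g y).
Proof.
have sa : smooth_at (fun w => g ** inv_e w ** linv g) o by exact: conj_smooth.
have ao : g ** inv_e o ** linv g = e by rewrite inv_e_o lmulg1 lmulgV.
have [_ D1] := derive_Ad (realv x) (Ad g y) sa ao.
rewrite -Ad_tangent (realvK x) in D1.
have [dy _] := derive_Ad_chart G y.
have [_ D2] := derive_complex_linear (Ad g) (realv x) dy.
apply: (can_inj (@realvK R n)); apply: etrans D1; apply: (etrans (esym D2)).
apply: eq_derive => w.
have -> : Ad (g ** inv_e w ** linv g) (Ad g y) = Ad g (Ad (inv_e w) y).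
  by rewrite -(AdM _ g) -(AdM g) -lmulA lmulVg lmulg1.
exact: (congr1 (fun t => realv (Ad g t)) (realvK (Ad (inv_e w) y))).
Qed.

(** [U] is the kernel of the linear map [L], the identity minus a projection onto [U]; since [L]
    kills [f] near [u], it kills the derivative. *)
Lemma memv_derive V (U : {vspace 'rV[R[i]]_n}) (f : V -> Cn R n) u v :
  differentiable f u -> (\forall w \near u, cplx (f w) \in U) -> cplx ('D_v f u) \in U.
Proof.
move=> df fU; pose L : 'End('rV[R[i]]_n) := (\1 - projv U)%VF.
have LE x : L x = x - projv U x by rewrite /L !lfunE /= !lfunE.
have L0 x : (L x == 0) = (x \in U).
  rewrite LE subr_eq0; apply/eqP/idP => [->|xU]; first exact: memv_proj.
  by rewrite projv_id.
have [_ D] := derive_complex_linear L v df.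
rewrite -L0 -[L _]realvK -D.
have -> : 'D_v (@realv R n \o L \o @cplx R n \o f) u = 0.
  rewrite -(derive_cst (0 : Cn R n) u v); apply: near_eq_derive.
  apply: filterS fU => w; rewrite -L0 => /eqP /= ->.
  by apply: (can_inj (@cplxK R n)); rewrite realvK cplx0.
by rewrite cplx0.
Qed.

End Bracket.

HB.instance Definition _ (R : realType) (n : nat) (G : complex_lie_group R n) x :=
  GRing.isLinear.Build R[i] 'rV[R[i]]_n 'rV[R[i]]_n *:%R (lie_bracket G x) (@lie_bracket_linearr R n G x).

(** The arguments are swapped so that linearity in the first argument of the bracket can be declared
    as a linear structure. *)
Definition bracket_with (R : realType) (n : nat) (G : complex_lie_group R n) (y x : 'rV[R[i]]_n) :=
  lie_bracket G x y.

HB.instance Definition _ (R : realType) (n : nat) (G : complex_lie_group R n) y :=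
  GRing.isLinear.Build R[i] 'rV[R[i]]_n 'rV[R[i]]_n *:%R (bracket_with G y) (@lie_bracket_linearl R n G y).

(** * The centre of a semisimple Lie algebra *)

Section Centre.
Variables (R : realType) (n : nat) (G : complex_lie_group R n).

(* The centre is an ideal because [Ad g] preserves it and an ideal is an
   infinitesimally [Ad]-invariant subspace. *)
Lemma semisimple_centreless (x : 'rV[R[i]]_n) : semisimple G ->
  (forall y, lie_bracket G x y = 0) -> x = 0.
Proof.
move=> ss xZ; pose Z := (\bigcap_(j : 'I_n) lker (linfun (bracket_with G (delta_mx 0%R j))))%VS.
have ZP z : reflect (forall y, lie_bracket G z y = 0) (z \in Z).
  apply: (iffP idP) => [zZ y|zZ].
    rewrite [y]row_sum_delta linear_sum big1 // => j _; rewrite linearZ /=.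
    have : z \in lker (linfun (bracket_with G (delta_mx 0%R j))).
      by apply: subvP zZ; exact: bigcapv_inf.
    by rewrite memv_ker lfunE /= /bracket_with => /eqP ->; rewrite scaler0.
  by rewrite memvE; apply/subv_bigcapP => j _; rewrite -memvE memv_ker lfunE /= /bracket_with zZ.
apply/eqP; rewrite -memv0; suff <- : Z = 0%VS by apply/ZP.
apply: ss => [u z /ZP zZ|].
  rewrite lie_bracketE; have [dz _] := derive_Ad_chart  G z.
  apply: (memv_derive _ dz).
  apply: filterS (near_open openT I) => w _; rewrite /Ad_chart realvK; apply/ZP => y.
  by rewrite -[y](AdKV (chart_inv (chart_at (lone G)) w)) -Ad_lie_bracket zZ linear0.
(* The centre is abelian, so one step of the derived series reaches 0. *)
exists 1%N; apply/eqP; rewrite /= -subv0 /derived_algebra; apply/span_subvP => w.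
move=> /allpairsP [[a b] [/= /vbasis_mem /ZP aZ _ ->]]; rewrite aZ; exact: mem0v.
Qed.

End Centre.

#[local] Opaque Ad lie_bracket cplx realv tangent_vector maurer_cartan.

(** * Gradations *)

Section Gradation.
Variables (R : realType) (n : nat) (G : complex_lie_group R n).
Variable (gr : int -> {vspace 'rV[R[i]]_n}).
Hypothesis grP : is_gradation G gr.
Implicit Types (Q : pred int) (x y : 'rV[R[i]]_n).

Lemma sub_sumv_seq (s : seq int) Q k : k \in s -> Q k ->
  (gr k <= \sum_(m <- s | Q m) gr m)%VS.
Proof.
move=> ks Qk; elim: s ks => [//|m s IH]; rewrite inE big_cons => /predU1P[<-|/IH sub].
  by rewrite Qk addvSl.
by case: (Q m) => //; exact: subv_trans sub (addvSr _ _).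
Qed.

(** Directness over [k :: s] and over [s] makes the dimensions of [gr k] and of the remaining sum
    add up, and equality in dim(U + V) <= dim U + dim V forces U and V to meet in 0. *)
Lemma gradation_disjoint k (s : seq int) :
  uniq (k :: s) -> (gr k :&: \sum_(m <- s) gr m = 0)%VS.
Proof.
move=> ks; have [dir _ _] := grP.
have us : uniq s by case/andP: ks.
have := dir _ ks; have := dir _ us; rewrite !directvE /= !big_cons => /eqP <-.
have [_ ->] := dimv_add_leqif (gr k) (\sum_(m <- s) gr m)%VS.
by rewrite subv0 => /eqP.
Qed.

Lemma gradation_independent (s : seq int) (v : int -> 'rV[R[i]]_n) : uniq s ->
  (forall m, v m \in gr m) -> \sum_(m <- s) v m = 0 -> {in s, forall m, v m = 0}.
Proof.
move=> us vgr; elim: s us => [//|k s IH] ks; rewrite big_cons => v0.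
have vk : v k = 0.
  apply/eqP; rewrite -memv0 -(gradation_disjoint ks) memv_cap vgr /=.
  rewrite -(addrK (\sum_(m <- s) v m) (v k)) v0 sub0r memvN [X in X \in _]big_seq.
  apply: memv_suml => j js; rewrite (bigD1_seq j) //=; last by case/andP: ks.
  by apply: subvP (vgr j); exact: addvSl.
move: v0; rewrite vk add0r => v0 m; rewrite inE => /predU1P[->//|].
by apply: IH => //; case/andP: ks.
Qed.

Lemma gradation_components : exists (s : seq int) (pi : int -> 'End('rV[R[i]]_n)),
  [/\ uniq s, forall m x, pi m x \in gr m, forall x, x = \sum_(m <- s) pi m x &
      forall k m x, x \in gr k -> pi m x = if m == k then x else 0].
Proof.
have [_ [s0 s0E] _] := grP; pose s := undup s0.
have us : uniq s by exact: undup_uniq.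
have defV : fullv = (\sum_(m <- s) gr m)%VS.
  apply/eqP; rewrite eqEsubv subvf andbT -s0E.
  rewrite [X in (X <= _)%VS]big_seq.
  apply: (big_ind (fun U => (U <= _)%VS)); [exact: sub0v|by move=> U U' sU; rewrite subv_add sU|].
  by move=> m ms; apply: sub_sumv_seq; rewrite ?mem_undup.
(* The sum over [s] is already everything, so any further summand meets it in itself. *)
have gr0 k : k \notin s -> gr k = 0%VS.
  move=> ks; have kus : uniq (k :: s) by rewrite /= ks.
  by rewrite -(gradation_disjoint kus) -defV capvf.
exists s, (sumv_pi_for defV).
have pi_gr m x : sumv_pi_for defV m x \in gr m by exact: memv_sum_pi.
have pi_sum x : x = \sum_(m <- s) sumv_pi_for defV m x.
  by rewrite sumv_pi_uniq_sum ?memvf // filter_predT.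
split=> // k m x xk.
have [ks|/gr0 gk0] := boolP (k \in s); last first.
  by move: xk; rewrite gk0 memv0 => /eqP ->; rewrite linear0 if_same.
(* The defects form a homogeneous family with zero sum, so independence makes them all vanish. *)
pose v j := sumv_pi_for defV j x - (if j == k then x else 0).
have vgr j : v j \in gr j.
  by apply: memvB => //; case: eqP => [->//|_]; exact: mem0v.
have v0 : \sum_(j <- s) v j = 0.
  rewrite sumrB -pi_sum (bigD1_seq k) //= eqxx big1 ?addr0 ?subrr // => j /negbTE ->.
  by [].
have [ms|/gr0 gm0] := boolP (m \in s).
  by apply/eqP; rewrite -subr_eq0; apply/eqP; exact: (gradation_independent us vgr v0 ms).
have := pi_gr m x; rewrite gm0 memv0 => /eqP ->.
by case: eqP => // mk; move: xk; rewrite -mk gm0 memv0 => /eqP.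
Qed.

Definition grading_support := projT1 (cid gradation_components).
Definition component := projT1 (cid (projT2 (cid gradation_components))).

Lemma componentP : [/\ uniq grading_support, forall m x, component m x \in gr m,
  forall x, x = \sum_(m <- grading_support) component m x &
  forall k m x, x \in gr k -> component m x = if m == k then x else 0].
Proof. exact: projT2 (cid (projT2 (cid gradation_components))). Qed.

(** A subspace counterpart of the set [graded_part], with one fixed finite index list, so that
    projections and [memv_derive] apply. *)
Definition graded_space Q : {vspace 'rV[R[i]]_n} := (\sum_(m <- grading_support | Q m) gr m)%VS.

Lemma graded_spaceP Q x :
  reflect (forall m, ~~ Q m -> component m x = 0) (x \in graded_space Q).
Proof.
have [us c_gr c_sum c_id] := componentP.
apply: (iffP idP) => [xQ m Qm|x0].
  suff : (graded_space Q <= lker (component m))%VS.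
    by move/subvP/(_ x xQ); rewrite memv_ker => /eqP.
  rewrite /graded_space; apply: (big_ind (fun U => (U <= lker (component m))%VS)).
  - exact: sub0v.
  - by move=> U U' sU sU'; rewrite subv_add sU.
  - move=> j Qj; apply/subvP => y /c_id cy; rewrite memv_ker cy.
    by case: (m =P j) => [mj|_]; [rewrite mj Qj in Qm|exact: eqxx].
rewrite [x]c_sum (bigID Q) /= [X in _ + X]big1 ?addr0 => [|m /x0 //].
rewrite big_seq_cond; apply: memv_suml => m /andP[ms Qm].
apply: subvP (c_gr m x); exact: sub_sumv_seq.
Qed.

Lemma graded_space_sub Q Q' : {subset Q <= Q'} -> (graded_space Q <= graded_space Q')%VS.
Proof.
move=> QQ'; apply/subvP => x /graded_spaceP x0; apply/graded_spaceP => m Qm.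
by apply: x0; apply: contra Qm; exact: QQ'.
Qed.

Lemma graded_space_gr Q k x : Q k -> x \in gr k -> x \in graded_space Q.
Proof.
have [_ _ _ c_id] := componentP.
move=> Qk /c_id xk; apply/graded_spaceP => m Qm; rewrite xk; case: eqP => // mk.
by rewrite mk Qk in Qm.
Qed.

Lemma graded_part_space Q x : graded_part gr Q x -> x \in graded_space Q.
Proof.
move=> [s sQ]; apply: subvP; elim: s sQ => [|k s IH] /=; first by rewrite big_nil sub0v.
move=> /andP[Qk /IH sU]; rewrite big_cons subv_add sU andbT.
by apply/subvP => y; exact: graded_space_gr.
Qed.

Lemma graded_space_cap0 Q Q' x : (forall m, Q m -> ~~ Q' m) ->
  x \in graded_space Q -> x \in graded_space Q' -> x = 0.
Proof.
have [_ _ c_sum _] := componentP.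
move=> QQ' /graded_spaceP xQ /graded_spaceP xQ'; rewrite [x]c_sum big1 // => m _.
by have [/QQ'/xQ'//|/xQ//] := boolP (Q m).
Qed.

(** The set of degrees k + Q. *)
Definition shift_pred Q (k : int) : pred int := fun m => Q (m - k).

Lemma lie_bracket_graded Q k x y :
  x \in graded_space Q -> y \in gr k -> lie_bracket G x y \in graded_space (shift_pred Q k).
Proof.
have [_ c_gr c_sum _] := componentP; have [_ _ br] := grP.
move=> /graded_spaceP xQ yk; rewrite [x]c_sum -/(bracket_with G y _) linear_sum /=.
apply: memv_suml => m _; have [Qm|/xQ ->] := boolP (Q m); last by rewrite linear0 mem0v.
apply: (@graded_space_gr _ (m + k)); first by rewrite /shift_pred addrK.
exact: br.
Qed.

(** For a degree m outside [Q] and homogeneous z of degree k, the bracket of the m-th component of x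
    with z is the component of degree m + k of the bracket of x with z, which vanishes. So the m-th
    component of x is central, hence 0. *)
Lemma graded_of_bracket Q x : semisimple G ->
  (forall k y, y \in gr k -> lie_bracket G x y \in graded_space (shift_pred Q k)) ->
  x \in graded_space Q.
Proof.
have [us c_gr c_sum c_id] := componentP; have [_ _ br] := grP.
move=> ss xQ; apply/graded_spaceP => m Qm; apply: (semisimple_centreless ss) => y.
rewrite [y]c_sum linear_sum big1 // => k _; have yk := c_gr k y; set z := component k y in yk *.
have /graded_spaceP/(_ (m + k)) := xQ k z yk.
rewrite /shift_pred addrK => /(_ Qm); rewrite [x in lie_bracket G x]c_sum.
rewrite -/(bracket_with G z _) !linear_sum /= => E.
have [ms|ms] := boolP (m \in grading_support).
  move: E; rewrite (bigD1_seq m) //= big1 ?addr0 => [|j jm].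
    by rewrite (c_id (m + k)) ?eqxx //; exact: br.
  rewrite (c_id (j + k)); last exact: br.
  by rewrite (inj_eq (addIr k)) eq_sym (negbTE jm).
have -> : component m x = 0.
  rewrite [LHS]c_sum big_seq big1 // => j js; rewrite (c_id m) //.
  by case: eqP => // jm; rewrite -jm js in ms.
by rewrite -/(bracket_with G z _) linear0.
Qed.

End Gradation.

(** * Subgroups recognized by the effect of [Ad] on degrees *)

Section GradedSubgroups.
Variables (R : realType) (n : nat) (G : complex_lie_group R n).
Variable (gr : int -> {vspace 'rV[R[i]]_n}).
Hypothesis grP : is_gradation G gr.
Implicit Types (V : normedModType R) (Q : pred int) (x y : 'rV[R[i]]_n) (g h : G).
Local Notation F := (graded_space grP).
Local Notation e := (lone G).
Local Infix "**" := (@lmul R n G) (at level 40, left associativity).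

Definition add_closed Q := forall k m, Q k -> Q m -> Q (k + m).

(* [Ad g] is the identity up to components whose degree is raised by an element
   of [Q]; for [Q] the predicates [0], [< 0], [> 0] this singles out the
   subgroups [H], [N_-], [N_+] up to the centre of [G]. *)
Definition unipotent_for Q g := forall k y, y \in gr k -> Ad g y - y \in F (shift_pred Q k).

Lemma unipotent_for_space Q g (P P' : pred int) y :
  (forall k m, P k -> Q m -> P' (k + m)) -> unipotent_for Q g -> y \in F P ->
  Ad g y - y \in F P'.
Proof.
have [us c_gr c_sum c_id] := componentP grP.
move=> PQ gQ /graded_spaceP yP; rewrite [y](c_sum) linear_sum /= -sumrB.
apply: memv_suml => m _; have [Pm|/yP ->] := boolP (P m); last first.
  by rewrite linear0 subrr mem0v.
apply: subvP (gQ m _ (c_gr m y)); apply: graded_space_sub => j Qj.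
by rewrite unfold_in -(subrK m j) addrC; exact: PQ.
Qed.

Lemma unipotent_for_stable Q g (P : pred int) y :
  (forall k m, P k -> Q m -> P (k + m)) -> unipotent_for Q g -> y \in F P -> Ad g y \in F P.
Proof. by move=> PQ gQ yP; rewrite -(subrK y (Ad g y)) memvD // (unipotent_for_space PQ). Qed.

Lemma unipotent_forM Q g h : add_closed Q ->
  unipotent_for Q g -> unipotent_for Q h -> unipotent_for Q (g ** h).
Proof.
move=> Qadd gQ hQ k y yk; rewrite AdM.
have -> : Ad g (Ad h y) - y = (Ad g (Ad h y - y) - (Ad h y - y)) + (Ad h y - y) + (Ad g y - y).
  by rewrite subrK linearB addrA subrK.
apply: memvD; last exact: gQ.
apply: memvD; last exact: hQ.
apply: (unipotent_for_space _ gQ (hQ k y yk)).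
by move=> j m; rewrite /shift_pred addrAC; exact: Qadd.
Qed.

Lemma unipotent_for1 Q : unipotent_for Q e.
Proof. by move=> k y _; rewrite Ad1 subrr mem0v. Qed.

(** With [L] a linear map of kernel [U], the curve L(Ad(a t) y - y) solves u' = B u with B = L o ad
    x: indeed ad x sends [U] to itself and [y] into [U], so L o ad x only depends on its argument
    modulo [U] and vanishes on [y]. As u(0) = 0, also u(1) = 0. *)
Lemma one_parameter_unipotent Q x (a : R -> G) : add_closed Q -> x \in F Q ->
  (forall s t, a (s + t) = a s ** a t) -> smooth_at (a : R^o -> G) 0 ->
  tangent_vector (a : R^o -> G) 0 1 = x -> unipotent_for Q (a 1).
Proof.
move=> Qadd xQ aD sa ax k y yk.
have a0 : a 0 = e by rewrite -(lmulKg (a 0) (a 0)) -aD addr0 lmulVg.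
have [L LE] : exists L : 'End('rV[R[i]]_n), forall z, L z = z - projv (F (shift_pred Q k)) z.
  by exists (\1 - projv (F (shift_pred Q k)))%VF => z; rewrite !lfunE /= !lfunE.
set U := F (shift_pred Q k) in LE *.
have L0 z : (L z == 0) = (z \in U).
  rewrite LE subr_eq0; apply/eqP/idP => [->|zU]; first exact: memv_proj.
  by rewrite projv_id.
pose u (t : R) : Cn R n := realv (L (Ad (a t) y - y)).
have [B BE] : exists B : {linear Cn R n -> Cn R n},
    forall v, B v = realv (L (lie_bracket G x (cplx v))).
  have Lx_lin : linear (fun z => L (lie_bracket G x z)).
    by move=> b v w; rewrite lie_bracket_linearr linearP.
  pose Lx : {linear 'rV[R[i]]_n -> 'rV[R[i]]_n} :=
    HB.pack (fun z => L (lie_bracket G x z)) (GRing.isLinear.Build _ _ _ _ _ Lx_lin).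
  have B_lin : linear (fun v : Cn R n => realv (L (lie_bracket G x (cplx v)))).
    exact: (realv_cplx_linear Lx).
  pose B : {linear Cn R n -> Cn R n} :=
    HB.pack (fun v : Cn R n => realv (L (lie_bracket G x (cplx v))))
      (GRing.isLinear.Build _ _ _ _ _ B_lin).
  by exists B => v; reflexivity.
have xU z : z \in U -> lie_bracket G x z \in U.
  have [us c_gr c_sum c_id] := componentP grP.
  move=> /graded_spaceP zU; rewrite [z]c_sum linear_sum; apply: memv_suml => m _.
  have [Qm|/zU ->] := boolP (shift_pred Q k m); last by rewrite linear0 mem0v.
  apply: subvP (lie_bracket_graded xQ (c_gr m z)); apply: graded_space_sub => j Qj.
  by rewrite unfold_in /shift_pred -(subrKA m); exact: Qadd.
have key z : L (lie_bracket G x z) = L (lie_bracket G x (L z)).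
  rewrite [in RHS](LE z) linearB linearB /= [X in _ - X](_ : _ = 0) ?subr0 //.
  by apply/eqP; rewrite L0; apply/xU/memv_proj.
have Lxy : L (lie_bracket G x y) = 0 by apply/eqP; rewrite L0; exact: lie_bracket_graded.
have Bkey (z : 'rV[R[i]]_n) : B (realv (L (z - y))) = realv (L (lie_bracket G x z)).
  apply: (etrans (BE _)); apply: (congr1 (@realv R n)).
  have -> : cplx (realv (L (z - y))) = L (z - y) by exact: realvK.
  have br : lie_bracket G x (z - y) = lie_bracket G x z - lie_bracket G x y by exact: linearB.
  apply: (etrans (esym (key _))); rewrite br.
  have Lbr : L (lie_bracket G x z - lie_bracket G x y) =
    L (lie_bracket G x z) - L (lie_bracket G x y) by exact: linearB.
  apply: (etrans Lbr); apply: (etrans (congr1 (fun t => L (lie_bracket G x z) - t) Lxy)).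
  exact: subr0.
have du (t : R) : is_derive t 1 u (B (u t)).
  pose z := Ad (a t) y; pose f (s : R^o) : Cn R n := realv (Ad (a s) z).
  have [df Df] := derive_Ad (1 : R^o) z sa a0.
  have [dLf DLf] := derive_complex_linear L (1 : R^o) df.
  pose g (s : R^o) : Cn R n := realv (L (Ad (a s) z - y)).
  have gE : g = (@realv R n \o L \o @cplx R n \o f) + cst (realv (- L y)).
    by apply/funext => s; rewrite /g linearB realvD /= !fctE /= /f realvK.
  have dg : differentiable g 0 by rewrite gE; apply: differentiableD => //; exact: differentiable_cst.
  have Dg : 'D_1 g 0 = realv (L (lie_bracket G x z)).
    rewrite gE deriveD ?derive_cst ?addr0; [|exact: diff_derivable|exact: derivable_cst].
    apply: (etrans DLf); rewrite -ax.
    exact: (congr1 (fun t => realv (L t)) (etrans (congr1 (@cplx R n) Df) (realvK _))).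
  (* The group law moves the derivative at time [t] to time 0, where it is a bracket with [x]. *)
  have uE : u = fun s : R => g (s + - t).
    by apply/funext => s; rewrite /u /g /z -AdM -aD subrK.
  rewrite uE; apply: DeriveDef.
    by apply: diff_derivable; apply: differentiable_translate; rewrite subrr.
  have t0 : t - t = 0 by exact: subrr.
  apply: (etrans (derive_translate _ _ _ _)).
  apply: (etrans _ (esym (congr1 (fun s => B (g s)) t0))).
  apply: (etrans (congr1 (fun s => 'D_1 g s) t0)); apply: (etrans Dg).
  have g0 : g 0 = realv (L (z - y)) by rewrite /g a0 Ad1.
  by rewrite g0; exact: esym (Bkey z).
have u0 : u 0 = 0.
  by rewrite /u a0 Ad1 subrr linear0; apply: (can_inj (@cplxK R n)); rewrite realvK cplx0.
have := linear_ode_zero (finite_coordinates_Cn R n) du u0.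
by move/(congr1 (@cplx R n)); rewrite /u realvK cplx0 => /eqP; rewrite L0.
Qed.


Lemma exp_unipotent Q x g : add_closed Q -> x \in F Q -> is_exp x g ->
  unipotent_for Q g /\ unipotent_for Q (linv g).
Proof.
move=> Qadd xQ [a [[aD ca sa] ax ->]].
have a0 : a 0 = e by rewrite -(lmulKg (a 0) (a 0)) -aD addr0 lmulVg.
have sa0 : smooth_at (a : R^o -> G) 0.
  exists e, (a @^-1` chart_dom (chart_at e)); first by rewrite /= a0; exact: mem_chart_at.
  split; last exact: (sa e).
    by apply: open_comp => [t _|]; [exact: ca|case: (chart_atP e)].
  by [].
have ta : tangent_vector (a : R^o -> G) 0 1 = x.
  by rewrite -[RHS](realvK x) -ax; rewrite -[in RHS]a0.
split; first exact: (one_parameter_unipotent Qadd xQ aD sa0 ta).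
(* The inverse curve is again a homomorphism; its velocity is [- x] because a(t) a(t)^-1 is
   constant. *)
apply: (@one_parameter_unipotent Q (- x) (fun t => linv (a t))) => //.
- by rewrite memvN.
- by move=> s t; rewrite addrC aD linvM.
- exact: smooth_at_inverse.
- have := tangent_vector_mul (1 : R^o) sa0 (smooth_at_inverse sa0) a0.
  rewrite a0 linv1 => /(_ erefl); rewrite ta => E; apply/eqP; rewrite -addr_eq0 addrC -E.
  rewrite (eq_tangent_vector (g := fun=> e)) ?tangent_vector_cst // => t.
  exact: lmulgV.
Qed.

(** The condition is imposed on [g] and its inverse together, so that the elements satisfying it
    form a subgroup without having to invert the estimate; this subgroup contains the generators. *)
Lemma connected_subgroup_unipotent Q g : add_closed Q ->
  connected_subgroup G (graded_part gr Q) g -> unipotent_for Q g /\ unipotent_for Q (linv g).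
Proof.
move=> Qadd gH; apply: (gH [set g | unipotent_for Q g /\ unipotent_for Q (linv g)]).
split=> [|h [x xQ xh]]; last exact: (exp_unipotent Qadd (graded_part_space grP xQ) xh).
split.
- by rewrite /= linv1; split; exact: unipotent_for1.
- by move=> h k [h1 h2] [k1 k2]; rewrite /= linvM; split; exact: unipotent_forM.
- by move=> h [h1 h2]; rewrite /= linvK.
Qed.

(** For homogeneous y, the increments Ad(f(u)^-1 f(w)) y - y remain in a fixed subspace, hence so
    does their derivative, the bracket of the logarithmic derivative with y. [graded_of_bracket]
    concludes. *)
Lemma log_derivative_graded Q V (f : V -> G) u v : semisimple G -> smooth_at f u ->
  (\forall w \near u, unipotent_for Q (linv (f u) ** f w)) ->
  log_derivative f u v \in F Q.
Proof.
move=> ss sf fQ; apply: graded_of_bracket => // k y yk; rewrite /log_derivative.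
have sa : smooth_at (fun w => linv (f u) ** f w) u.
  by apply: smooth_at_mul => //; exact: smooth_at_cst.
have [df Df] := derive_Ad v y sa (lmulVg (f u)).
set X := tangent_vector _ u v in Df *.
pose h w : Cn R n := realv (Ad (linv (f u) ** f w) y) + - realv y.
have dh : differentiable h u by apply: differentiableD => //; exact: differentiable_cst.
have Dh : 'D_v h u = realv (lie_bracket G X y).
  rewrite deriveD ?derive_cst ?addr0 //; exact: diff_derivable.
rewrite -[lie_bracket G X y]realvK -Dh; apply: memv_derive dh _.
by apply: filterS fQ => w wQ; rewrite /h cplxD cplxN !realvK; exact: wQ.
Qed.

End GradedSubgroups.

(** * The components of the connection *)

Section Coordinates.
Variables (R : realType) (m n : nat) (M : complex_manifold R m) (N : complex_manifold R n).
Local Notation c := chart_at.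

Lemma smooth_map_smooth_at (W : set M) (f : M -> N) p :
  open W -> smooth_map W f -> W p -> smooth_map_at f p.
Proof.
move=> Wo [cf sf] Wp; have cp := chart_atP p.
pose A := W `&` chart_dom (c p) `&` f @^-1` chart_dom (c (f p)).
exists (f p), (chart_fun (c p) @` A).
  by exists p => //; split; [split|]=> //; exact: mem_chart_at.
split.
- apply: open_chart_image => //; first by move=> q [[]].
  apply: open_near => q [[Wq pq] fq]; apply: filterI; first apply: filterI.
  + exact: near_open.
  + exact: chart_dom_near.
  + by apply: (cf q Wq); exact: (chart_dom_near (chart_atP (f p))).
- by move=> _ [q [[Wq pq] fq] <-] /=; rewrite chart_invK.
- exact: (sf p (f p)).
Qed.

Lemma transition_derive (z : chart R M m) p v : is_chart z -> transition z (c p) ->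
  chart_dom z p ->
  differentiable (chart_fun (c p) \o chart_inv z) (chart_fun z p) /\
  'D_(mul_i v) (chart_fun (c p) \o chart_inv z) (chart_fun z p) =
  mul_i ('D_v (chart_fun (c p) \o chart_inv z) (chart_fun z p)).
Proof.
move=> zP [st ht] zp.
have zpp : (chart_fun z @` (chart_dom z `&` chart_dom (c p))) (chart_fun z p).
  by exists p => //; split=> //; exact: mem_chart_at.
by split; [exact: (Ck_near_differentiable st zpp)|exact: (ht _ v zpp)].
Qed.

Lemma chart_change_near (z : chart R M m) (f : M -> N) p : is_chart z -> chart_dom z p ->
  \forall u \near chart_fun z p,
    ((f \o chart_inv (c p)) \o (chart_fun (c p) \o chart_inv z)) u = (f \o chart_inv z) u.
Proof.
move=> zP zp.
have zo : open (chart_fun z @` (chart_dom z `&` chart_dom (c p))).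
  apply: open_chart_image => //.
  by apply: openI; [case: zP|case: (chart_atP p)].
have zpp : (chart_fun z @` (chart_dom z `&` chart_dom (c p))) (chart_fun z p).
  by exists p => //; split=> //; exact: mem_chart_at.
apply: filterS (near_open zo zpp) => _ [q [zq pq] <-] /=.
by rewrite (chart_invK zP) // (chart_invK (chart_atP p)).
Qed.

Lemma smooth_at_coordinate (z : chart R M m) (f : M -> N) p : is_chart z ->
  transition z (c p) -> chart_dom z p -> smooth_map_at f p ->
  smooth_at (f \o chart_inv z) (chart_fun z p).
Proof.
move=> zP [st ht] zp sf; apply: near_smooth_at (chart_change_near f zP zp) _.
have zo : open (chart_fun z @` (chart_dom z `&` chart_dom (c p))).
  apply: open_chart_image => //.
  by apply: openI; [case: zP|case: (chart_atP p)].
have zpp : (chart_fun z @` (chart_dom z `&` chart_dom (c p))) (chart_fun z p).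
  by exists p => //; split=> //; exact: mem_chart_at.
apply: (smooth_at_comp (finite_coordinates_Cn _ _) zo st zpp).
by rewrite /= (chart_invK zP).
Qed.

Lemma smooth_at_smooth_map (W : set M) (f : M -> N) :
  (forall p, W p -> smooth_map_at f p) -> smooth_map W f.
Proof.
move=> sf; split=> [p Wp|p q k].
  have pp := mem_chart_at p; have cp := chart_atP p.
  have fE : \forall x \near p, (f \o chart_inv (c p) \o chart_fun (c p)) x = f x.
    by apply: filterS (chart_dom_near cp pp) => x px /=; rewrite (chart_invK cp).
  have : {for p, continuous (f \o chart_inv (c p) \o chart_fun (c p))}.
    apply: continuous_comp; first exact: chart_fun_cont.
    exact: (smooth_at_continuous (sf p Wp)).
  rewrite /prop_for /continuous_at (nbhs_singleton fE) => cf.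
  by apply: cvg_trans cf; apply: near_eq_cvg; exact: fE.
apply: Ck_local => _ [x [[Wx px] qx] <-].
have sx := smooth_at_coordinate (chart_atP p) (transition_chart_at p x) px (sf x Wx).
have [|U Ux [_ _ sU]] := smooth_at_chart (q := q) sx.
  by rewrite /= (chart_invK (chart_atP p)).
by exists U => //; exact: sU.
Qed.

(** The Cauchy-Riemann equations pass from the preferred chart at [p] to the coordinate [z]. Leaving
    [J] free covers holomorphic and antiholomorphic maps at once. *)
Lemma derive_coordinate_mul_i (z : chart R M m) (W : set M) (f : M -> N) p v
    (J : Cn R n -> Cn R n) :
  is_chart z -> transition z (c p) -> chart_dom z p -> W p ->
  holomorphic_on (@mul_i R m) J (loc_dom W (c p) (c (f p)) f) (loc_rep (c p) (c (f p)) f) ->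
  'D_(mul_i v) (loc_rep z (c (f p)) f) (chart_fun z p) =
  J ('D_v (loc_rep z (c (f p)) f) (chart_fun z p)).
Proof.
move=> zP zt zp Wp [sf hf].
pose F := loc_rep (c p) (c (f p)) f; pose tau := chart_fun (c p) \o chart_inv z.
have [dtau itau] := transition_derive v zP zt zp.
have tauE : tau (chart_fun z p) = chart_fun (c p) p by rewrite /tau /= (chart_invK zP).
have Dp : loc_dom W (c p) (c (f p)) f (tau (chart_fun z p)).
  by rewrite tauE; exists p => //; split; [split|]=> //; exact: mem_chart_at.
have dF : differentiable F (tau (chart_fun z p)) := Ck_near_differentiable sf Dp.
have E w : 'D_w (loc_rep z (c (f p)) f) (chart_fun z p) =
    'D_('D_w tau (chart_fun z p)) F (tau (chart_fun z p)).
  rewrite -(derive_comp w dtau dF); apply: near_eq_derive.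
  by apply: filterS (chart_change_near f zP zp) => u uE;
    exact: (congr1 (chart_fun (c (f p))) (esym uE)).
rewrite (E (mul_i v)) (E v) itau; exact: (hf _ ('D_v tau (chart_fun z p)) Dp).
Qed.

End Coordinates.

(** * The dz and dzbar components of the connection form *)

Section Wirtinger.
Variables (R : realType) (n : nat) (M : complex_manifold R 1) (G : complex_lie_group R n).
Variables (z : chart R M 1) (zP : is_coordinate z) (W : set M) (Wo : open W).
Hypothesis Wz : W `<=` chart_dom z.
Implicit Types (f h : M -> G) (s : R[i]).
Local Notation e_x := ((const_mx 1, 0) : Cn R 1).
Local Notation e_y := ((0, const_mx 1) : Cn R 1).
Local Infix "**" := (@lmul R n G) (at level 40, left associativity).

(** For [s] equal to -i this is the dz component, for [s] equal to i the dzbar component; the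
    parameter lets both be treated together. *)
Definition wirtinger s f p : 'rV[R[i]]_n :=
  2^-1 *: (log_derivative (f \o chart_inv z) (chart_fun z p) e_x +
           s *: log_derivative (f \o chart_inv z) (chart_fun z p) e_y).

Lemma maurer_cartan_combination (g : G) s x y :
  maurer_cartan g (2^-1 *: (x + s *: y)) =
  2^-1 *: (maurer_cartan g x + s *: maurer_cartan g y).
Proof.
pose mc : {linear 'rV[R[i]]_n -> 'rV[R[i]]_n} :=
  HB.pack (maurer_cartan g) (GRing.isLinear.Build _ _ _ _ _ (maurer_cartan_linear g)).
suff : mc (2^-1 *: (x + s *: y)) = 2^-1 *: (mc x + s *: mc y) by [].
by move: mc => mc; rewrite linearZ linearD linearZ.
Qed.

Lemma maurer_cartan0 (g : G) : maurer_cartan g 0 = 0.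
Proof.
pose mc : {linear 'rV[R[i]]_n -> 'rV[R[i]]_n} :=
  HB.pack (maurer_cartan g) (GRing.isLinear.Build _ _ _ _ _ (maurer_cartan_linear g)).
suff : mc 0 = 0 by [].
exact: linear0.
Qed.

Lemma linear_combination_add (L : {linear 'rV[R[i]]_n -> 'rV[R[i]]_n}) (t s : R[i]) a1 a2 b1 b2 :
  t *: ((L a1 + b1) + s *: (L a2 + b2)) = L (t *: (a1 + s *: a2)) + t *: (b1 + s *: b2).
Proof.
by rewrite linearZ /= linearD /= linearZ /= [s *: (L a2 + _)]scalerDr addrACA scalerDr.
Qed.

Lemma coordinate_chart : is_chart z. Proof. by case: zP. Qed.

Lemma coordinate_invK p : W p -> chart_inv z (chart_fun z p) = p.
Proof. by move=> Wp; apply: (chart_invK coordinate_chart); exact: Wz. Qed.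

Lemma smooth_in_coordinate f p : smooth_map W f -> W p ->
  smooth_at (f \o chart_inv z) (chart_fun z p).
Proof.
move=> sf Wp; apply: smooth_at_coordinate; [exact: coordinate_chart| |exact: Wz|].
  by case: zP => _ /(_ p) [].
exact: (smooth_map_smooth_at Wo sf).
Qed.

Lemma near_coordinate p : W p -> \forall u \near chart_fun z p, W (chart_inv z u).
Proof.
move=> Wp; apply: (chart_inv_cont coordinate_chart (Wz Wp)).
by rewrite coordinate_invK //; exact: near_open.
Qed.

Lemma maurer_cartan_wirtinger s f p : smooth_map W f -> W p ->
  let F := loc_rep z (chart_at (f p)) f in
  maurer_cartan (f p) (2^-1 *: (d_x F (chart_fun z p) + s *: d_y F (chart_fun z p))) =
  wirtinger s f p.
Proof.
move=> sf Wp F; have sf' := smooth_in_coordinate sf Wp.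
pose g := f \o chart_inv z; pose u := chart_fun z p.
have gu : g u = f p by rewrite /g /u /= coordinate_invK.
have T v : cplx ('D_v F u) = tangent_vector g u v by rewrite tangent_vectorE gu.
have mcT v : maurer_cartan (f p) (tangent_vector g u v) = log_derivative g u v.
  by rewrite -gu; exact: maurer_cartan_log_derivative.
have dx : d_x F (chart_fun z p) = tangent_vector g u e_x by exact: T.
have dy : d_y F (chart_fun z p) = tangent_vector g u e_y by exact: T.
rewrite dx dy; apply: (etrans (maurer_cartan_combination _ _ _ _)).
exact: (congr2 (fun a b => 2^-1 *: (a + s *: b)) (mcT e_x) (mcT e_y)).
Qed.

Lemma omega_minus_wirtinger f p : smooth_map W f -> W p ->
  omega_minus z f p = wirtinger (- 'i%C) f p.
Proof.
move=> sf Wp; apply: etrans (maurer_cartan_wirtinger (- 'i%C) sf Wp).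
by rewrite scaleNr.
Qed.

Lemma omega_plus_wirtinger f p : smooth_map W f -> W p ->
  omega_plus z f p = wirtinger 'i%C f p.
Proof. by move=> sf Wp; rewrite -maurer_cartan_wirtinger. Qed.

Lemma eq_wirtinger s f h p : (forall q, W q -> f q = h q) -> W p ->
  wirtinger s f p = wirtinger s h p.
Proof.
move=> fh Wp.
have E : \forall u \near chart_fun z p, (f \o chart_inv z) u = (h \o chart_inv z) u.
  by apply: filterS (near_coordinate Wp) => u /fh.
by rewrite /wirtinger !(near_log_derivative _ E).
Qed.

Lemma wirtinger_mul s f h p : smooth_map W f -> smooth_map W h -> W p ->
  wirtinger s (pt_mul f h) p = Ad (linv (h p)) (wirtinger s f p) + wirtinger s h p.
Proof.
move=> sf sh Wp; rewrite /wirtinger.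
have E v : log_derivative (pt_mul f h \o chart_inv z) (chart_fun z p) v =
    Ad (linv (h p)) (log_derivative (f \o chart_inv z) (chart_fun z p) v) +
    log_derivative (h \o chart_inv z) (chart_fun z p) v.
  rewrite -[h p](congr1 h (coordinate_invK Wp)).
  apply: (@log_derivative_mul _ _ _ _ (f \o chart_inv z) (h \o chart_inv z)).
    exact: smooth_in_coordinate.
  exact: smooth_in_coordinate.
by rewrite !E; exact: linear_combination_add.
Qed.

Lemma wirtinger_graded (gr : int -> {vspace 'rV[R[i]]_n}) (grP : is_gradation G gr)
    (Q : pred int) s f p : semisimple G -> smooth_map W f -> W p ->
  (forall q, W q -> unipotent_for grP Q (linv (f p) ** f q)) ->
  wirtinger s f p \in graded_space grP Q.
Proof.
move=> ss sf Wp fQ; rewrite /wirtinger.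
have E v : log_derivative (f \o chart_inv z) (chart_fun z p) v \in graded_space grP Q.
  apply: log_derivative_graded => //; first exact: smooth_in_coordinate.
  apply: filterS (near_coordinate Wp) => u Wu; rewrite /= coordinate_invK //; exact: fQ.
by apply/memvZ/memvD => //; exact: memvZ.
Qed.

(** If [J] acts as the scalar [t], then d_y = t d_x and the combination d_x + s d_y is (1 + s t)
    d_x. The cases of interest are s = t = i and s = t = -i. *)
Lemma wirtinger_eq0 s t f p (J : Cn R n -> Cn R n) : smooth_map W f -> W p ->
  holomorphic_on (@mul_i R 1) J (loc_dom W (chart_at p) (chart_at (f p)) f)
                 (loc_rep (chart_at p) (chart_at (f p)) f) ->
  (forall v, cplx (J v) = t *: cplx v) -> s * t = -1 -> wirtinger s f p = 0.
Proof.
move=> sf Wp hf Jt st; have sf' := smooth_in_coordinate sf Wp.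
have zpP : transition z (chart_at p) by case: zP => _ /(_ p) [].
rewrite -maurer_cartan_wirtinger //.
have -> : d_y (loc_rep z (chart_at (f p)) f) (chart_fun z p) =
    t *: d_x (loc_rep z (chart_at (f p)) f) (chart_fun z p).
  rewrite /d_x /d_y -Jt -(derive_coordinate_mul_i _ coordinate_chart zpP (Wz Wp) Wp hf).
  by rewrite /mul_i /= oppr0.
rewrite scalerA st scaleN1r subrr scaler0.
exact: maurer_cartan0.
Qed.

Lemma sqr_i : 'i%C * 'i%C = -1 :> R[i].
Proof. by apply/eqP; rewrite eq_complex /= !mul0r !mulr0 !mul1r sub0r addr0 oppr0 !eqxx. Qed.

Lemma wirtinger_holomorphic f p : holomorphic_map W f -> W p -> wirtinger 'i%C f p = 0.
Proof.
move=> [cf hf] Wp.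
have sf : smooth_map W f by split=> // q r; case: (hf q r).
apply: (wirtinger_eq0 sf Wp (hf p (f p))) (@cplx_mul_i R n) sqr_i.
Qed.

Lemma wirtinger_antiholomorphic f p :
  antiholomorphic_map W f -> W p -> wirtinger (- 'i%C) f p = 0.
Proof.
move=> [cf hf] Wp.
have sf : smooth_map W f by split=> // q r; case: (hf q r).
apply: (wirtinger_eq0 (t := - 'i%C) sf Wp (hf p (f p))).
  by move=> v; rewrite cplxN cplx_mul_i scaleNr.
by rewrite mulrNN sqr_i.
Qed.

Lemma smooth_map_mul f h : smooth_map W f -> smooth_map W h -> smooth_map W (pt_mul f h).
Proof.
move=> sf sh; apply: smooth_at_smooth_map => p Wp.
apply: (@smooth_at_mul _ _ _ _ (f \o _) (h \o _)).
  exact: (smooth_map_smooth_at Wo sf Wp).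
exact: (smooth_map_smooth_at Wo sh Wp).
Qed.

Lemma smooth_map_inv f : smooth_map W f -> smooth_map W (pt_inv f).
Proof.
move=> sf; apply: smooth_at_smooth_map => p Wp.
apply: (@smooth_at_inverse _ _ _ _ (f \o _)); exact: (smooth_map_smooth_at Wo sf Wp).
Qed.

End Wirtinger.

#[local] Opaque wirtinger.

(** * Comparison of the two decompositions, for both components at once *)

Section Gauge.
Variables (R : realType) (n : nat) (M : complex_manifold R 1) (G : complex_lie_group R n).
Variables (Gss : semisimple G) (gr : int -> {vspace 'rV[R[i]]_n}) (grP : is_gradation G gr).
Variables (z : chart R M 1) (zP : is_coordinate z) (W : set M) (Wo : open W).
Hypothesis Wz : W `<=` chart_dom z.
Local Notation F := (graded_space grP).
Local Notation Om := (wirtinger z).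
Local Notation Q0 := (fun m : int => m == 0).
Local Infix "**" := (@lmul R n G) (at level 40, left associativity).

(* [Qm], [Qp] are [< 0], [> 0] or vice versa, and [k] is [-1], respectively [1]. *)
Variables (Qm Qp : pred int) (k : int).
Hypotheses (Qm_add : add_closed Qm) (Qp_add : add_closed Qp) (Qmk : Qm k).
Hypotheses (Qm_disj : forall m, Qm m -> ~~ (Qp m || (m == 0))).
Hypotheses (Qp_disj : forall m, Qp m -> ~~ (Qm m || (m == 0))).
Hypotheses (Qp_shift : forall m, Qp m -> Qp (k + m) || (k + m == 0)).
Variables (f mu1 nu1 eta1 mu2 nu2 eta2 : M -> G) (g1 g2 : G).
Hypotheses (mu1P : smooth_into W [set a | connected_subgroup G (graded_part gr Qp) (linv g1 ** a)] mu1)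
  (nu1P : smooth_into W (connected_subgroup G (graded_part gr Qm)) nu1)
  (eta1P : smooth_into W (connected_subgroup G (graded_part gr Q0)) eta1)
  (mu2P : smooth_into W [set a | connected_subgroup G (graded_part gr Qm) (linv g2 ** a)] mu2)
  (nu2P : smooth_into W (connected_subgroup G (graded_part gr Qp)) nu2)
  (eta2P : smooth_into W (connected_subgroup G (graded_part gr Q0)) eta2)
  (f1 : forall p, W p -> f p = mu1 p ** nu1 p ** eta1 p)
  (f2 : forall p, W p -> f p = mu2 p ** nu2 p ** eta2 p).

Lemma Q0_add : add_closed Q0.
Proof. by move=> i j /eqP -> /eqP ->; rewrite addr0. Qed.

Lemma subgroup_unipotent Q (S : M -> G) p : add_closed Q ->
  smooth_into W (connected_subgroup G (graded_part gr Q)) S -> W p ->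
  unipotent_for grP Q (S p) /\ unipotent_for grP Q (linv (S p)).
Proof. by move=> Qadd [_ SQ] /SQ; exact: connected_subgroup_unipotent. Qed.

Lemma subgroup_wirtinger Q s (S : M -> G) p : add_closed Q ->
  smooth_into W (connected_subgroup G (graded_part gr Q)) S -> W p -> Om s S p \in F Q.
Proof.
move=> Qadd SQ Wp; apply: (wirtinger_graded zP Wo Wz _ Gss SQ.1 Wp).
move=> q Wq; apply: unipotent_forM => //.
  by have [] := subgroup_unipotent Qadd SQ Wp.
by have [] := subgroup_unipotent Qadd SQ Wq.
Qed.

Lemma coset_wirtinger Q s (g : G) (S : M -> G) p : add_closed Q ->
  smooth_into W [set a | connected_subgroup G (graded_part gr Q) (linv g ** a)] S ->
  W p -> Om s S p \in F Q.
Proof.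
move=> Qadd [sS SQ] Wp; apply: (wirtinger_graded zP Wo Wz _ Gss sS Wp) => q Wq.
(* The constant [g] labelling the coset cancels in the logarithmic derivative. *)
have -> : linv (S p) ** S q = linv (linv g ** S p) ** (linv g ** S q).
  by rewrite linvM linvK -lmulA lmulVKg.
have [_ uQ] := connected_subgroup_unipotent grP Qadd (SQ p Wp).
have [vQ _] := connected_subgroup_unipotent grP Qadd (SQ q Wq).
exact: unipotent_forM.
Qed.

Lemma wirtinger_mul3 s (mu nu eta : M -> G) p : (forall q, W q -> f q = mu q ** nu q ** eta q) ->
  smooth_map W mu -> smooth_map W nu -> smooth_map W eta -> W p ->
  Om s f p = Ad (linv (eta p)) (Ad (linv (nu p)) (Om s mu p) + Om s nu p) + Om s eta p.
Proof.
move=> fE smu snu seta Wp.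
have smn : smooth_map W (pt_mul mu nu) by exact: smooth_map_mul.
apply: (etrans (eq_wirtinger zP Wo Wz s (h := pt_mul (pt_mul mu nu) eta) fE Wp)).
apply: (etrans (wirtinger_mul zP Wo Wz s smn seta Wp)).
by rewrite (wirtinger_mul zP Wo Wz s smu snu Wp).
Qed.

Lemma Ad_stable (P : pred int) g y : unipotent_for grP Q0 g -> y \in F P -> Ad g y \in F P.
Proof. by apply: unipotent_for_stable => i j Pi /eqP ->; rewrite addr0. Qed.

(* The degree-zero part of [Om s f] is read off the first decomposition, the
   part of degree [k] off the second. *)
Lemma wirtinger_decomposition s p : W p ->
  Om s f p \in F (fun m => Qm m || (m == 0)) -> Om s mu2 p \in F (fun m => m == k) ->
  Om s f p = Ad (linv (eta2 p)) (Om s mu2 p) + Om s eta1 p.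
Proof.
move=> Wp fQ muk.
have E1 := wirtinger_mul3 s f1 mu1P.1 nu1P.1 eta1P.1 Wp.
have E2 := wirtinger_mul3 s f2 mu2P.1 nu2P.1 eta2P.1 Wp.
have A := coset_wirtinger s Qp_add mu1P Wp.
have B := subgroup_wirtinger s Qm_add nu1P Wp.
have C := subgroup_wirtinger s Q0_add eta1P Wp.
have D := subgroup_wirtinger s Qp_add nu2P Wp.
have E := subgroup_wirtinger s Q0_add eta2P Wp.
have [n1 n1'] := subgroup_unipotent Qm_add nu1P Wp.
have [h1 h1'] := subgroup_unipotent Q0_add eta1P Wp.
have [n2 n2'] := subgroup_unipotent Qp_add nu2P Wp.
have [h2 h2'] := subgroup_unipotent Q0_add eta2P Wp.
have sub (P P' : pred int) x : (forall m, P m -> P' m) -> x \in F P -> x \in F P'.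
  by move=> PP'; apply: subvP; apply: graded_space_sub.
move: E1 E2 A B C D E fQ muk.
move: (Om s f p) (Om s mu1 p) (Om s nu1 p) (Om s eta1 p) (Om s mu2 p) (Om s nu2 p) (Om s eta2 p).
move=> w a b c l d e' E1 E2 A B C D E fQ muk.
pose Qm0 m := Qm m || (m == 0); pose Qp0 m := Qp m || (m == 0).
(* [a] has degrees in [Qp]; solving the first decomposition for it also gives degrees in [Qm] or 0,
   by the hypothesis on the component of [f]. *)
have a0 : a = 0.
  apply: (@graded_space_cap0 _ _ _ _ grP _ Qm0 _ Qp_disj A).
  have -> : a = Ad (nu1 p) (Ad (eta1 p) (w - c) - b) by rewrite E1 addrK AdKV addrK AdKV.
  apply: (unipotent_for_stable (P := Qm0) _ n1).
    by move=> i j /orP[Qi|/eqP ->] Qj; rewrite /Qm0 ?add0r ?Qj // Qm_add.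
  apply: memvB; last by apply: sub B => m; rewrite /Qm0 => ->.
  apply: (Ad_stable h1); apply: memvB fQ _.
  by apply: sub C => m; rewrite /Qm0 orbC => ->.
have wc : w - c \in F Qm.
  have -> : w - c = Ad (linv (eta1 p)) b by rewrite E1 a0 linear0 add0r addrK.
  exact: (Ad_stable h1').
apply/eqP; rewrite -subr_eq0; apply/eqP.
(* The difference of the two sides has degrees in [Qm] by the first decomposition, and in [Qp] or 0
   by the second, where [Ad] of the [Qp]-factor changes [l] only in degrees above or below [k], as
   allowed by [Qp_shift]. *)
apply: (@graded_space_cap0 _ _ _ _ grP _ Qp0 _ Qm_disj).
  rewrite opprD addrA addrAC; apply: memvB wc _; apply: (Ad_stable h2').
  by apply: sub muk => m /eqP ->.
have EX : Ad (linv (eta2 p)) (Ad (linv (nu2 p)) l - l + d) =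
    Ad (linv (eta2 p)) (Ad (linv (nu2 p)) l + d) - Ad (linv (eta2 p)) l.
  by rewrite addrAC; exact: linearB.
have -> : w - (Ad (linv (eta2 p)) l + c) =
    Ad (linv (eta2 p)) (Ad (linv (nu2 p)) l - l + d) + (e' - c).
  by rewrite EX E2 opprD addrACA.
have sub0 x : x \in F Q0 -> x \in F Qp0 by apply: sub => m; rewrite /Qp0 orbC => ->.
apply: memvD; last by apply: memvB; exact: sub0.
apply: (Ad_stable h2').
apply: memvD; last by apply: sub D => m; rewrite /Qp0 => ->.
by apply: (unipotent_for_space (P' := Qp0) _ n2' muk) => i j /eqP ->; exact: Qp_shift.
Qed.

End Gauge.

(** * The gauge transformation *)

Lemma connected_subgroupM (R : realType) (n : nat) (G : complex_lie_group R n)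
    (a : set 'rV[R[i]]_n) g h :
  connected_subgroup G a g -> connected_subgroup G a h -> connected_subgroup G a (lmul g h).
Proof.
by move=> ga ha A [sA aA]; have [_ AM _] := sA; apply: AM; [exact: ga|exact: ha].
Qed.

Lemma connected_subgroupV (R : realType) (n : nat) (G : complex_lie_group R n)
    (a : set 'rV[R[i]]_n) g :
  connected_subgroup G a g -> connected_subgroup G a (linv g).
Proof. by move=> ga A [sA aA]; have [_ _ AV] := sA; apply: AV; exact: ga. Qed.

Theorem theorem2p3 (R : realType) (M : complex_manifold R 1)
  (n : nat) (G : complex_lie_group R n)
  (Gconn : connected [set: G]) (Gss : semisimple G)
  (gr : int -> {vspace 'rV[R[i]]_n}) (grP : is_gradation G gr)
  (xm xp : 'rV[R[i]]_n)
  (xm_gr : xm \in gr (-1)) (xm_neq0 : xm != 0)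
  (xp_gr : xp \in gr 1) (xp_neq0 : xp != 0)
  (km kp : nat) (Fm : complex_manifold R km) (Fp : complex_manifold R kp)
  (pim : G -> Fm) (pip : G -> Fp)
  (pimP : is_quotient_manifold (Bplus G gr) pim)
  (pipP : is_quotient_manifold (Bminus G gr) pip)
  (phi : M -> G) (phi_smooth : smooth_map setT phi)
  (phi_adm : admissible gr xm xp pim pip phi)
  (W : set M) (Wopen : open W)
  (z : chart R M 1) (zP : is_coordinate z) (Wz : W `<=` chart_dom z)
  (gm gp : G) (mum mup num nup etam etap : M -> G)
  (mumP : smooth_into W [set a | Nminus G gr (lmul (linv gm) a)] mum)
  (mupP : smooth_into W [set a | Nplus G gr (lmul (linv gp) a)] mup)
  (numP : smooth_into W (Nminus G gr) num)
  (nupP : smooth_into W (Nplus G gr) nup)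
  (etamP : smooth_into W (Hsub G gr) etam)
  (etapP : smooth_into W (Hsub G gr) etap)
  (phi_dec1 : forall p, W p -> phi p = lmul (lmul (mup p) (num p)) (etam p))
  (phi_dec2 : forall p, W p -> phi p = lmul (lmul (mum p) (nup p)) (etap p))
  (gamm gamp : M -> G)
  (gammP : smooth_into W (Hsub G gr) gamm)
  (gampP : smooth_into W (Hsub G gr) gamp)
  (gamm_hol : holomorphic_map W gamm)
  (gamp_antihol : antiholomorphic_map W gamp)
  (gamm_lambda : forall p, W p -> omega_minus z mum p = 'i%C *: Ad (gamm p) xm)
  (gamp_lambda : forall p, W p -> omega_plus z mup p = 'i%C *: Ad (gamp p) xp) :
  let eta := pt_mul etam (pt_inv etap) in
  let gam := pt_mul (pt_mul (pt_inv gamp) eta) gamm in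
  smooth_into W (Hsub G gr) gam /\
  exists2 psi : M -> G, smooth_into W (Hsub G gr) psi &
    forall p, W p ->
      omega_minus z (pt_mul phi psi) p = 'i%C *: xm + omega_minus z gam p /\
      omega_plus z (pt_mul phi psi) p = 'i%C *: Ad (linv (gam p)) xp.
Proof.
move=> eta gam.
have sphi : smooth_map W phi.
  apply: smooth_at_smooth_map => p _; exact: (smooth_map_smooth_at openT phi_smooth).
have H_into (f h : M -> G) : smooth_into W (Hsub G gr) f -> smooth_into W (Hsub G gr) h ->
    smooth_into W (Hsub G gr) (pt_mul f h).
  move=> [sf fH] [sh hH]; split; first exact: smooth_map_mul.
  by move=> p Wp; apply: connected_subgroupM; [exact: fH|exact: hH].
have H_inv (f : M -> G) : smooth_into W (Hsub G gr) f -> smooth_into W (Hsub G gr) (pt_inv f).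
  move=> [sf fH]; split; first exact: smooth_map_inv.
  by move=> p Wp; apply: connected_subgroupV; exact: fH.
pose psi := pt_mul (pt_inv etap) gamm.
have psiH : smooth_into W (Hsub G gr) psi by exact: (H_into _ _ (H_inv _ etapP) gammP).
have gamH : smooth_into W (Hsub G gr) gam.
  exact: (H_into _ _ (H_into _ _ (H_inv _ gampP) (H_into _ _ etamP (H_inv _ etapP))) gammP).
split=> //; exists psi => // p Wp.
have [adm_m adm_p _ _] := phi_adm z p zP (Wz p Wp).
have spsi : smooth_map W (pt_mul phi psi) by apply: smooth_map_mul => //; case: psiH.
rewrite (omega_minus_wirtinger zP Wopen Wz spsi Wp) (omega_plus_wirtinger zP Wopen Wz spsi Wp).
rewrite (omega_minus_wirtinger zP Wopen Wz gamH.1 Wp).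
rewrite (omega_minus_wirtinger zP Wopen Wz sphi Wp) in adm_m.
rewrite (omega_plus_wirtinger zP Wopen Wz sphi Wp) in adm_p.
have lm := gamm_lambda p Wp; have lp := gamp_lambda p Wp.
rewrite (omega_minus_wirtinger zP Wopen Wz mumP.1 Wp) in lm.
rewrite (omega_plus_wirtinger zP Wopen Wz mupP.1 Wp) in lp.
have adm_sum k (Q : pred int) (x : 'rV[R[i]]_n) : Q k -> Q 0 -> x \in (gr k + gr 0%R)%VS -> x \in graded_space grP Q.
  move=> Qk Q0 /memv_addP [a ak [b b0 ->]].
  by apply: memvD; [exact: (graded_space_gr grP Qk)|exact: (graded_space_gr grP Q0)].
have H_Ad k (x : 'rV[R[i]]_n) (g : G) : Hsub G gr g -> x \in gr k -> Ad g x \in graded_space grP (fun m => m == k).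
  move=> gH xk; have [gu _] := connected_subgroup_unipotent grP Q0_add gH.
  exact: (Ad_stable gu (graded_space_gr grP (Q := fun m => m == k) (eqxx k) xk)).
have neg_add : add_closed (fun m : int => m < 0).
  by move=> i j i0 j0; rewrite -[X in _ < X]addr0 ltrD.
have pos_add : add_closed (fun m : int => 0 < m) by move=> i j; exact: addr_gt0.
have sum_gr (Q : pred int) k (x : 'rV[R[i]]_n) : Q k -> x \in (gr k + gr 0%R)%VS ->
    x \in graded_space grP (fun m => Q m || (m == 0)).
  by move=> Qk; apply: adm_sum; rewrite ?Qk ?eqxx ?orbT.
have Em : wirtinger z (- 'i%C) phi p =
    Ad (linv (etap p)) (wirtinger z (- 'i%C) mum p) + wirtinger z (- 'i%C) etam p.
  apply: (wirtinger_decomposition Gss (grP := grP) zP Wopen Wz (Qm := fun m => m < 0)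
    (Qp := fun m => 0 < m) (k := -1) neg_add pos_add _ _ _ _
    mupP numP etamP mumP nupP etapP phi_dec1 phi_dec2 Wp).
  - by [].
  - by move=> m /=; lia.
  - by move=> m /=; lia.
  - by move=> m /=; lia.
  - exact: (sum_gr (fun m => m < 0) (-1)).
  - by rewrite lm; apply: memvZ; apply: H_Ad xm_gr; exact: gammP.2.
(* The same lemma with the signs of the degrees and the two decompositions exchanged. *)
have Ep : wirtinger z 'i%C phi p =
    Ad (linv (etam p)) (wirtinger z 'i%C mup p) + wirtinger z 'i%C etap p.
  apply: (wirtinger_decomposition Gss (grP := grP) zP Wopen Wz (Qm := fun m => 0 < m)
    (Qp := fun m => m < 0) (k := 1) pos_add neg_add _ _ _ _
    mumP nupP etapP mupP numP etamP phi_dec2 phi_dec1 Wp).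
  - by [].
  - by move=> m /=; lia.
  - by move=> m /=; lia.
  - by move=> m /=; lia.
  - by apply: (sum_gr (fun m => 0 < m) 1) => //; rewrite addvC.
  - by rewrite lp; apply: memvZ; apply: H_Ad xp_gr; exact: gampP.2.
have Ad_psi x : Ad (linv (psi p)) x = Ad (linv (gamm p)) (Ad (etap p) x).
  by rewrite /psi /pt_mul /pt_inv linvM linvK AdM.
have mul_s s (f : M -> G) : smooth_map W f -> wirtinger z s (pt_mul f psi) p =
    Ad (linv (psi p)) (wirtinger z s f p) + wirtinger z s psi p.
  by move=> sf; exact: (wirtinger_mul zP Wopen Wz s sf psiH.1 Wp).
have eq_s s (f h : M -> G) : (forall q, W q -> f q = h q) ->
    wirtinger z s f p = wirtinger z s h p.
  by move=> fh; exact: (eq_wirtinger zP Wopen Wz s fh Wp).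
have Ad0 (g : G) : Ad g 0 = 0 by exact: linear0.
have AdD (g : G) (x y : 'rV[R[i]]_n) : Ad g (x + y) = Ad g x + Ad g y by exact: linearD.
have AdZ (g : G) (a : R[i]) (x : 'rV[R[i]]_n) : Ad g (a *: x) = a *: Ad g x by exact: linearZ.
(* Here eta_- psi = gamma_+ gamma, and the antiholomorphic gamma_+ has no dz component. *)
have etam_psi : wirtinger z (- 'i%C) (pt_mul etam psi) p = wirtinger z (- 'i%C) gam p.
  apply: (etrans (eq_s _ _ (pt_mul gamp gam) _)).
    by move=> q _; rewrite /gam /eta /psi /pt_mul /pt_inv -!lmulA lmulVKg.
  apply: (etrans (wirtinger_mul zP Wopen Wz _ gampP.1 gamH.1 Wp)).
  by rewrite (wirtinger_antiholomorphic zP Wopen Wz gamp_antihol Wp) Ad0 add0r.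
have etap_psi : wirtinger z 'i%C (pt_mul etap psi) p = 0.
  apply: (etrans (eq_s _ _ gamm _)).
    by move=> q _; rewrite /psi /pt_mul /pt_inv lmulVKg.
  exact: (wirtinger_holomorphic zP Wopen Wz gamm_hol Wp).
(* The inhomogeneous term of the gauge transformation is absorbed by the component of [f]; only [l]
   is conjugated. *)
have gauge s (l : 'rV[R[i]]_n) (f : M -> G) : smooth_map W f -> wirtinger z s phi p = l + wirtinger z s f p ->
    wirtinger z s (pt_mul phi psi) p = Ad (linv (psi p)) l + wirtinger z s (pt_mul f psi) p.
  move=> sf E; apply: (etrans (mul_s _ _ sphi)); rewrite E (mul_s s f sf).
  exact: (etrans (congr1 (fun t => t + wirtinger z s psi p) (AdD _ _ _)) (esym (addrA _ _ _))).
split.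
- apply: (etrans (gauge _ _ _ etamP.1 Em)); rewrite etam_psi lm Ad_psi AdKV AdZ.
  exact: (congr1 (fun t => 'i%C *: t + wirtinger z (- 'i%C) gam p) (AdK (gamm p) xm)).
(* The successive adjoint actions are those of gamma_-^-1 eta_+ eta_-^-1 gamma_+, that is of
   gamma^-1. *)
- apply: (etrans (gauge _ _ _ etapP.1 Ep)); rewrite etap_psi addr0 lp Ad_psi AdZ AdZ AdZ.
  apply: (congr1 ( *:%R 'i%C)).
  by rewrite /gam /eta /pt_mul /pt_inv !linvM !linvK !AdM.
Qed.
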